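(* Let $n\ge2$. Suppose every $f_i:\mathbb{R}^d\to\mathbb{R}$ is differentiable with $L$-Lipschitz gradient (not necessarily convex), $F=\frac1n\sum_{i=1}^nf_i$ is $\mu$-strongly convex with $0<\mu\le L$, and, for some $\nu\in(0,1]$ and $\rho_\nu\ge0$, $F$ is twice differentiable with $\|\nabla^2F(u)-\nabla^2F(v)\|_{\mathrm{op}}\le\rho_\nu\|u-v\|^\nu$ for all $u,v$; let $\psi:\mathbb{R}^d\to\mathbb{R}\cup\{+\infty\}$ be proper, closed and convex. Let $x^\dagger$ be the unique minimizer of $\mathcal P=F+\psi$ and $\beta_\star=\|\nabla F(x^\dagger)\|$. Suppose ProxRR is run with constant component stepsize $\eta>0$ such that $h=n\eta\le\frac{\mu}{64L^2}$. Then for every $K\ge1$, with $T=nK$ and $c_\nu=\frac{2^{-(1+\nu)}}{1+\nu}$, $$ \mathbb{E}\|y_K-x^\dagger\|^2\le e^{-\mu\eta T/2}D_{\mathrm c}^2+\frac{18L^2}{\mu^2}h^2\beta_\star^2+\frac{64L^2G_{\mathrm c}^2}{\mu^2}\eta^2+\frac{6L^2G_{\mathrm c}^2}{\mu}n^2\eta^3+\frac{32c_\nu^2\rho_\nu^2G_{\mathrm c}^{2+2\nu}}{\mu^2}n^{1+\nu}\eta^{2+2\nu}. $$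
   Context: ProxRR (one proximal step per epoch) with constant component stepsize $\eta>0$ and $h=n\eta$ starts from a deterministic $y_0\in\mathbb{R}^d$. At each epoch $k=0,1,\dots$ it draws a fresh, independent, uniformly random permutation $\pi_k$ of $\{1,\dots,n\}$, sets $x_{k,0}=y_k$, performs $x_{k,i}=x_{k,i-1}-\eta\nabla f_{\pi_k(i)}(x_{k,i-1})$ for $i=1,\dots,n$, and sets $y_{k+1}=\operatorname{prox}_{h\psi}(x_{k,n})$, where $\operatorname{prox}_{\tau\psi}(z):=\operatorname{argmin}_u\{\tau\psi(u)+\frac12\|u-z\|^2\}$. Expectations are over the permutations. Constants: $G_{\star,\mathrm c}:=\max_i\|\nabla f_i(x^\dagger)\|$, $D_{\mathrm c}:=\max\{\|y_0-x^\dagger\|,\,G_{\star,\mathrm c}/(2L)\}$, $G_{\mathrm c}:=G_{\star,\mathrm c}+2LD_{\mathrm c}$. *)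

(* Defs.v *)
From HB Require Import structures.
From mathcomp Require Import all_boot all_order all_algebra all_fingroup finmap.
From mathcomp Require Import all_classical all_reals all_analysis.

Set Implicit Arguments.
Unset Strict Implicit.
Unset Printing Implicit Defensive.

Import Order.TTheory GRing.Theory Num.Theory.
Import numFieldNormedType.Exports.

Local Open Scope classical_set_scope.
Local Open Scope ring_scope.

(* The library norm of 'rV[R]_d is the sup norm, hence a separate Euclidean norm.
   The sup norm enters only through the topology and [differentiable], which in
   finite dimension do not depend on the choice of norm. *)
Definition enorm (R : realType) (d : nat) (x : 'rV[R]_d) : R :=
  Num.sqrt (\sum_(j < d) x ord0 j ^+ 2).

Definition grad (R : realType) (d : nat) (f : 'rV[R]_d -> R) (x : 'rV[R]_d)
    : 'rV[R]_d :=
  \row_(j < d) 'D_(delta_mx ord0 j) f x.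

(* The library Jacobian acts on row vectors: 'd (grad f) x v = v *m 'J (grad f) x;
   [opnorm] below uses the same convention. *)
Definition hessian (R : realType) (d : nat) (f : 'rV[R]_d -> R) (x : 'rV[R]_d)
    : 'M[R]_d :=
  'J (grad f) x.

Definition opnorm (R : realType) (d : nat) (A : 'M[R]_d) : R :=
  sup [set enorm (v *m A) | v in [set v : 'rV[R]_d | enorm v <= 1]].

Definition lipschitz_gradient (R : realType) (d : nat) (L : R)
    (f : 'rV[R]_d -> R) : Prop :=
  forall x y : 'rV[R]_d, enorm (grad f x - grad f y) <= L * enorm (x - y).

Definition twice_differentiable (R : realType) (d : nat)
    (f : 'rV[R]_d -> R) : Prop :=
  (forall x : 'rV[R]_d, differentiable f x) /\
  (forall x : 'rV[R]_d, differentiable (grad f) x).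

Definition holder_hessian (R : realType) (d : nat) (nu rho : R)
    (f : 'rV[R]_d -> R) : Prop :=
  forall u v : 'rV[R]_d,
    opnorm (hessian f u - hessian f v) <= rho * enorm (u - v) `^ nu.

Definition strongly_convex (R : realType) (d : nat) (mu : R)
    (f : 'rV[R]_d -> R) : Prop :=
  forall (x y : 'rV[R]_d) (t : R), 0 <= t <= 1 ->
    f ((1 - t) *: x + t *: y) <=
      (1 - t) * f x + t * f y - mu / 2 * t * (1 - t) * enorm (x - y) ^+ 2.

(* The value -oo of \bar R is excluded: psi takes values in R U {+oo}. *)
Definition proper_fun (R : realType) (d : nat) (psi : 'rV[R]_d -> \bar R)
    : Prop :=
  (forall x, psi x != -oo%E) /\ (exists x, psi x != +oo%E).

Definition closed_fun (R : realType) (d : nat) (psi : 'rV[R]_d -> \bar R)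
    : Prop :=
  closed [set p : 'rV[R]_d * R | (psi p.1 <= p.2%:E)%E].

(* At t = 0 and t = 1 the convention 0 * +oo = 0 makes the inequality trivial. *)
Definition convex_fun (R : realType) (d : nat) (psi : 'rV[R]_d -> \bar R)
    : Prop :=
  forall (x y : 'rV[R]_d) (t : R), 0 <= t <= 1 ->
    (psi ((1 - t) *: x + t *: y)%R <=
      (1 - t)%:E * psi x + t%:E * psi y)%E.

Definition argmin (R : realType) (d : nat) (g : 'rV[R]_d -> \bar R)
    : set 'rV[R]_d :=
  [set x | forall u, (g x <= g u)%E].

(* [get] picks an element of a nonempty set; for psi proper, closed and convex
   and tau > 0 the argmin set is a singleton. *)
Definition prox (R : realType) (d : nat) (tau : R)
    (psi : 'rV[R]_d -> \bar R) (z : 'rV[R]_d) : 'rV[R]_d :=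
  get (argmin (fun u =>
    (tau%:E * psi u + (2^-1 * enorm (u - z) ^+ 2)%:E)%E)).

Definition avg (R : realType) (d n : nat) (f : 'I_n -> 'rV[R]_d -> R)
    (x : 'rV[R]_d) : R :=
  n%:R^-1 * \sum_(i < n) f i x.

(* x_{k,n} from x_{k,0} = y; [enum 'I_n] lists 0, ..., n - 1 increasingly, so
   the components are visited in the order s 0, s 1, ..., s (n - 1). *)
Definition rr_epoch (R : realType) (d n : nat) (f : 'I_n -> 'rV[R]_d -> R)
    (eta : R) (s : 'S_n) (y : 'rV[R]_d) : 'rV[R]_d :=
  foldl (fun x i => x - eta *: grad (f (s i)) x) y (enum 'I_n).

Fixpoint proxrr (R : realType) (d n : nat) (f : 'I_n -> 'rV[R]_d -> R)
    (psi : 'rV[R]_d -> \bar R) (eta : R) (y0 : 'rV[R]_d) (pi : nat -> 'S_n)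
    (k : nat) : 'rV[R]_d :=
  if k is k'.+1 then
    prox (n%:R * eta) psi
      (rr_epoch f eta (pi k') (proxrr f psi eta y0 pi k'))
  else y0.

Definition uniform_perm (R : realType) (disp : measure_display)
    (Omega : measurableType disp) (P : probability Omega R) (n : nat)
    (X : Omega -> 'S_n) : Prop :=
  forall s : 'S_n, measurable (X @^-1` [set s]) /\
    P (X @^-1` [set s]) = ((n`!)%:R^-1)%:E.

Definition mutually_independent (R : realType) (disp : measure_display)
    (Omega : measurableType disp) (P : probability Omega R) (n : nat)
    (X : nat -> Omega -> 'S_n) : Prop :=
  forall (J : {fset nat}) (A : nat -> set 'S_n),
    P (\bigcap_(k in [set` J]) (X k @^-1` A k)) =
    (\prod_(k <- J) P (X k @^-1` A k))%E.

(* Main.v *)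
Require Import Defs.
From mathcomp Require Import all_boot all_order all_algebra all_fingroup finmap.
From mathcomp Require Import all_classical all_reals all_analysis.
From mathcomp Require Import measurable_realfun ring lra.

Import Order.TTheory GRing.Theory Num.Theory.
Import numFieldNormedType.Exports.

Local Open Scope ring_scope.

(* The proximal step is nonexpansive and, since - grad F xdag is a subgradient of
   psi at xdag, it maps xdag - h grad F xdag to xdag.  It therefore suffices to
   bound, for one epoch started at y, the mean square distance of the last inner
   iterate x_n to xdag - h grad F xdag.  It splits into a variance and the square
   of the distance of the mean m_n to that point.

   For the variance, the noise grad f_(s j) - grad F, evaluated along the
   deterministic path of the means m_j, is a sum sampled without replacement; over a
   full epoch the part frozen at y cancels, which leaves L h eta sqrt(n) G.

   The means follow gradient descent on F up to two biases.  Exchanging positions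
   i and j < i of the permutation shows that E grad f_(s i)(x_i) differs from
   E grad F(x_i) by O(L eta G), although each f_i is only once differentiable.
   Expanding grad F at m_i, the linear term averages out and the Hoelder remainder
   is controlled by the variance.  Comparing with the straight path
   p_i = xdag - i eta grad F xdag, strong convexity contracts the difference and
   produces the drift inequality E |y'-xdag|^2 <= (1 - th) |y-xdag|^2 + N with
   th = (9/10) mu h, valid on the invariant ball |y-xdag| <= D. *)

(** * Euclidean norm *)

Section Euclid.
Context {R : realType} {d : nat}.
Implicit Types u v w : 'rV[R]_d.

Definition dot u v : R := \sum_(j < d) u ord0 j * v ord0 j.

Lemma dotC u v : dot u v = dot v u.
Proof. by apply: eq_bigr => j _; rewrite mulrC. Qed.

Lemma dotDl u v w : dot (u + v) w = dot u w + dot v w.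
Proof. by rewrite -big_split; apply: eq_bigr => j _; rewrite mxE mulrDl. Qed.

Lemma dotZl a u v : dot (a *: u) v = a * dot u v.
Proof. by rewrite [RHS]mulr_sumr; apply: eq_bigr => j _; rewrite mxE mulrA. Qed.

Lemma dotNl u v : dot (- u) v = - dot u v.
Proof. by rewrite -scaleN1r dotZl mulN1r. Qed.

Lemma dotDr u v w : dot w (u + v) = dot w u + dot w v.
Proof. by rewrite dotC dotDl !(dotC w). Qed.

Lemma dotZr a u v : dot u (a *: v) = a * dot u v.
Proof. by rewrite dotC dotZl dotC. Qed.

Lemma dotNr u v : dot u (- v) = - dot u v.
Proof. by rewrite dotC dotNl dotC. Qed.

Lemma dot0l u : dot 0 u = 0.
Proof. by rewrite -(scale0r u) dotZl mul0r. Qed.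

Lemma dot_suml (I : Type) (r : seq I) (Q : pred I) (F : I -> 'rV[R]_d) v :
  dot (\sum_(i <- r | Q i) F i) v = \sum_(i <- r | Q i) dot (F i) v.
Proof.
elim/big_rec2: _ => [|i x y _ <-]; [exact: dot0l | exact: dotDl].
Qed.

Lemma dot_ge0 u : 0 <= dot u u.
Proof. by apply: sumr_ge0 => j _; rewrite -expr2 sqr_ge0. Qed.

Lemma enorm_sqr u : enorm u ^+ 2 = dot u u.
Proof.
rewrite /enorm sqr_sqrtr; last by apply: sumr_ge0 => j _; exact: sqr_ge0.
by apply: eq_bigr.
Qed.

Lemma enorm_ge0 u : 0 <= enorm u.
Proof. exact: sqrtr_ge0. Qed.

Lemma enorm_le u a : 0 <= a -> dot u u <= a ^+ 2 -> enorm u <= a.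
Proof. by move=> a0; rewrite -enorm_sqr ler_pXn2r // nnegrE ?enorm_ge0. Qed.

Lemma enorm0 : enorm (0 : 'rV[R]_d) = 0.
Proof. by apply/eqP; rewrite -sqrf_eq0 enorm_sqr dot0l. Qed.

Lemma enorm_eq0 u : enorm u = 0 -> u = 0.
Proof.
move=> u0; have : dot u u = 0 by rewrite -enorm_sqr u0 expr0n.
move/eqP; rewrite psumr_eq0 => [/allP uj|j _]; last by rewrite -expr2 sqr_ge0.
apply/rowP => j; rewrite mxE; apply/eqP; rewrite -sqrf_eq0 expr2.
by apply: uj; rewrite mem_index_enum.
Qed.

Lemma enormZ a u : enorm (a *: u) = `|a| * enorm u.
Proof.
apply/eqP; rewrite -(@eqrXn2 _ 2) ?mulr_ge0 ?enorm_ge0 ?normr_ge0 //.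
by rewrite exprMn !enorm_sqr dotZl dotZr mulrA -expr2 -normrX ger0_norm ?sqr_ge0.
Qed.

Lemma enormN u : enorm (- u) = enorm u.
Proof. by rewrite -scaleN1r enormZ normrN normr1 mul1r. Qed.

Lemma enormB u v : enorm (u - v) = enorm (v - u).
Proof. by rewrite -enormN opprB. Qed.

(** Cauchy-Schwarz, read off from the square of [enorm v *: u - enorm u *: v]. *)
Lemma dot_le u v : dot u v <= enorm u * enorm v.
Proof.
have [v0|v0] := eqVneq (enorm v) 0.
  by rewrite (enorm_eq0 _ v0) dotC dot0l enorm0 mulr0.
have vp : 0 < enorm v by rewrite lt_def v0 enorm_ge0.
have [u0|u0] := eqVneq (enorm u) 0.
  by rewrite (enorm_eq0 _ u0) dot0l enorm0 mul0r.
have up : 0 < enorm u by rewrite lt_def u0 enorm_ge0.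
have := dot_ge0 (enorm v *: u - enorm u *: v).
rewrite !(dotDl, dotDr, dotNl, dotNr, dotZl, dotZr) -!enorm_sqr (dotC v u).
rewrite [X in 0 <= X](_ : _ =
  2 * (enorm u * enorm v) * (enorm u * enorm v - dot u v)); last by ring.
by rewrite pmulr_rge0 ?subr_ge0 // mulr_gt0 ?mulr_gt0.
Qed.

Lemma ler_enormD u v : enorm (u + v) <= enorm u + enorm v.
Proof.
apply: enorm_le; first by rewrite addr_ge0 ?enorm_ge0.
rewrite !(dotDl, dotDr) -!enorm_sqr (dotC v u); have := dot_le u v.
by move=> uv; nra.
Qed.

Lemma ler_enormB u v : enorm (u - v) <= enorm u + enorm v.
Proof. by rewrite -(enormN v) ler_enormD. Qed.

Lemma ler_enorm_sum (I : Type) (r : seq I) (Q : pred I) (F : I -> 'rV[R]_d) :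
  enorm (\sum_(i <- r | Q i) F i) <= \sum_(i <- r | Q i) enorm (F i).
Proof.
elim/big_rec2: _ => [|i x y _ le]; first by rewrite enorm0.
by apply: le_trans (ler_enormD _ _) _; rewrite lerD2l.
Qed.

Lemma enormD_sqr u v : enorm (u + v) ^+ 2 = enorm u ^+ 2 + 2 * dot u v + enorm v ^+ 2.
Proof. by rewrite !enorm_sqr !(dotDl, dotDr) (dotC v u); ring. Qed.

Lemma enormB_sqr u v : enorm (u - v) ^+ 2 = enorm u ^+ 2 - 2 * dot u v + enorm v ^+ 2.
Proof. by rewrite enormD_sqr dotNr enormN mulrN. Qed.

Lemma enormD_sqr_le a u v : 0 < a ->
  enorm (u + v) ^+ 2 <= (1 + a) * enorm u ^+ 2 + (1 + a^-1) * enorm v ^+ 2.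
Proof.
move=> a0; rewrite enormD_sqr.
have := sqr_ge0 (enorm (a *: u - v)); rewrite enormB_sqr dotZl enormZ gtr0_norm // => h.
have : 0 <= a^-1 * ((a * enorm u) ^+ 2 - 2 * (a * dot u v) + enorm v ^+ 2).
  by rewrite mulr_ge0 // invr_ge0 ltW.
have -> : a^-1 * ((a * enorm u) ^+ 2 - 2 * (a * dot u v) + enorm v ^+ 2) =
  a * enorm u ^+ 2 - 2 * dot u v + a^-1 * enorm v ^+ 2 by field; lra.
lra.
Qed.

End Euclid.

(** With [a] equal to [F] cut off to zero outside [Q], the double sum of [enorm (a i - a j) ^+ 2] is
    nonnegative and equals twice the gap between the two sides. *)
Lemma sqr_enorm_sum_le {R : realType} {d n : nat} (Q : pred 'I_n) (F : 'I_n -> 'rV[R]_d) :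
  enorm (\sum_(i < n | Q i) F i) ^+ 2 <= n%:R * \sum_(i < n | Q i) enorm (F i) ^+ 2.
Proof.
rewrite !(big_mkcond Q) /=.
set a := fun i => if Q i then F i else 0.
rewrite (eq_bigr a) // [X in _ <= _ * X](eq_bigr (fun i => enorm (a i) ^+ 2)); last first.
  by move=> i _; rewrite /a; case: ifP; rewrite // enorm0 expr0n.
set N := \sum_i enorm (a i) ^+ 2.
have H : 0 <= \sum_(i < n) \sum_(j < n) enorm (a i - a j) ^+ 2.
  by apply: sumr_ge0 => i _; apply: sumr_ge0 => j _; exact: sqr_ge0.
have E i : \sum_(j < n) enorm (a i - a j) ^+ 2 =
    n%:R * enorm (a i) ^+ 2 - 2 * dot (a i) (\sum_j a j) + N.
  under eq_bigr do rewrite enormB_sqr.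
  rewrite big_split sumrB /= sumr_const card_ord -[_ *+ n]mulr_natl -mulr_sumr.
  congr (_ - 2 * _ + _); rewrite dotC dot_suml.
  by apply: eq_bigr => j _; exact: dotC.
move: H; rewrite (eq_bigr _ (fun i _ => E i)) big_split sumrB /=.
rewrite sumr_const card_ord -!mulr_sumr -dot_suml -/N -[_ *+ n]mulr_natl enorm_sqr; lra.
Qed.

(** * Gradients and Hessians *)

Lemma is_derive_line {R : realType} {V W : normedModType R} (g : V -> W) (z v : V) (t : R) :
  derivable g (z + t *: v) v ->
  is_derive t 1 (fun s : R => g (z + s *: v)) ('D_v g (z + t *: v)).
Proof.
have E : (fun h : R => h^-1 *: (((fun s : R => g (z + s *: v)) \o shift t) (h *: 1%R) - g (z + t *: v)))
   = (fun h : R => h^-1 *: ((g \o shift (z + t *: v)) (h *: v) - g (z + t *: v))).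
  apply/funext => h /=; rewrite [h%:A]mulr1 scalerDl addrCA //.
move=> dg; split.
  by rewrite /derivable E.
by rewrite /derive E.
Qed.

Section OneSidedDerivative.
Context {R : realType} {V : normedModType R}.
Implicit Types (f : V -> R) (x v : V).

(** The quadratic error [t ^+ 2 * b] disappears from the one-sided difference quotient as t tends to
    0. *)
Lemma derive_le f x v (a b : R) : derivable f x v ->
  (forall t : R, 0 < t <= 1 -> f (x + t *: v) - f x <= t * a + t ^+ 2 * b) ->
  'D_v f x <= a.
Proof.
move=> df le_f; apply/ler_addgt0Pr => e e0.
rewrite /derive (cvg_at_rightE (fun h : R => h^-1 *: ((f \o shift x) (h *: v) - f x))) //.
apply: limr_le.
  rewrite -(cvg_at_rightE (fun h : R => h^-1 *: ((f \o shift x) (h *: v) - f x))) //.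
  apply: cvg_trans df; apply: cvg_app => A [r r0 Ar]; exists r => // t tr t0.
  by apply: Ar => //; exact: lt0r_neq0.
near=> t.
have t0 : 0 < t by near: t; exact: nbhs_right_gt.
have t1 : t <= 1 by near: t; exact: nbhs_right_le.
have tb : t * (`|b| + 1) <= e.
  rewrite -ler_pdivlMr ?ltr_wpDl //; near: t; apply: nbhs_right_le.
  by rewrite divr_gt0 // ltr_wpDl.
rewrite /= [t *: v + x]addrC.
rewrite -[_ *: _]/(t^-1 * _) ler_pdivrMl //. apply: le_trans (le_f _ _) _.
  by rewrite t0 t1.
have := ler_norm b; nra.
Unshelve. all: by end_near. Qed.

Lemma derive_ge f x v (a : R) : derivable f x v ->
  (forall t : R, 0 < t <= 1 -> t * a <= f (x + t *: v) - f x) -> a <= 'D_v f x.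
Proof.
move=> df ge_f; rewrite -lerN2 -deriveN //.
apply: (@derive_le _ _ _ _ 0); first exact: derivableN.
move=> t t01; rewrite mulr0 addr0 mulrN opprfctE -opprD lerN2; exact: ge_f.
Qed.

End OneSidedDerivative.

Section Gradient.
Context {R : realType} {d : nat}.
Implicit Types (f : 'rV[R]_d -> R) (x y z v w : 'rV[R]_d).

Lemma derive_grad f x v : differentiable f x -> 'D_v f x = dot (grad f x) v.
Proof.
move=> df; rewrite deriveE // {1}(row_sum_delta v) linear_sum.
by apply: eq_bigr => j _; rewrite linearZ /= /grad [in RHS]mxE deriveE //; exact: mulrC.
Qed.

(** Strong monotonicity: the first-order inequality [H] is written at (x, y) and at (y, x), and the
    two are added. *)
Lemma strongly_convex_grad mu f x y :
  (forall z, differentiable f z) -> strongly_convex mu f ->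
  mu * enorm (x - y) ^+ 2 <= dot (grad f x - grad f y) (x - y).
Proof.
move=> df cf.
have H u v : dot (grad f u) (v - u) <= f v - f u - mu / 2 * enorm (u - v) ^+ 2.
  rewrite -derive_grad //.
  (* In [t * (1 - t)] the linear part enters the slope; the quadratic part is the error that
     [derive_le] tolerates. *)
  apply: (@derive_le _ _ _ _ _ _ (mu / 2 * enorm (u - v) ^+ 2)); first exact: diff_derivable.
  move=> t /andP[t0 t1]; have := cf u v t; rewrite (ltW t0) t1 => /(_ isT).
  have -> : (1 - t) *: u + t *: v = u + t *: (v - u).
    by rewrite scalerBl scale1r scalerBr addrAC addrA.
  lra.
have := H x y; have := H y x.
rewrite dotDl dotNl (_ : dot (grad f x) (y - x) = - dot (grad f x) (x - y)).
  rewrite (enormB y x); lra.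
by rewrite -dotNr opprB.
Qed.

Lemma is_derive_dot (M : R -> 'rV[R]_d) w (t : R) (dM : 'rV[R]_d) :
  is_derive t 1 M dM -> is_derive t 1 (fun s => dot (M s) w) (dot dM w).
Proof.
move=> [dMt <-]; have dMj := (derivable_mxP _ _ _).1 dMt.
have -> : (fun s => dot (M s) w) = \sum_(j < d) (fun s => w ord0 j *: M s ord0 j).
  apply/funext => s; rewrite fct_sumE; apply: eq_bigr => j _; exact: mulrC.
rewrite derive_mx // /dot; under [X in is_derive _ _ _ X]eq_bigr do rewrite mxE mulrC.
apply: is_derive_sum => j; apply: is_deriveZ; exact/derivableP/dMj.
Qed.

End Gradient.

Section Hessian.
Context {R : realType} {d : nat}.
Implicit Types (f : 'rV[R]_d -> R) (x y z v w : 'rV[R]_d).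

Lemma ler_coord_enorm v j : `|v ord0 j| <= enorm v.
Proof.
rewrite -[leLHS]sqrtr_sqr ler_wsqrtr // (bigD1 j) //= lerDl.
by apply: sumr_ge0 => i _; exact: sqr_ge0.
Qed.

Lemma opnorm_le v (A : 'M[R]_d) : enorm (v *m A) <= opnorm A * enorm v.
Proof.
(* [sup] dominates its set only when the set is bounded above; here the coordinates of [w] are at
   most 1 in absolute value. *)
have ubA : has_ubound [set enorm (w *m A) | w in [set w : 'rV[R]_d | enorm w <= 1]]%classic.
  exists (\sum_(j < d) enorm (row j A)) => _ [w /= w1 <-].
  rewrite mulmx_sum_row; apply: le_trans (ler_enorm_sum _ _ _ _) _.
  apply: ler_sum => j _; rewrite enormZ ler_piMl ?enorm_ge0 //.
  by apply: le_trans w1; exact: ler_coord_enorm.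
have [v0|v0] := eqVneq (enorm v) 0.
  by rewrite (enorm_eq0 _ v0) mul0mx enorm0 mulr0.
have vp : 0 < enorm v by rewrite lt_def v0 enorm_ge0.
rewrite -ler_pdivrMr //; apply: (ub_le_sup ubA).
exists ((enorm v)^-1 *: v) => /=.
  by rewrite enormZ gtr0_norm ?invr_gt0 // mulVf.
by rewrite -scalemxAl enormZ gtr0_norm ?invr_gt0 // mulrC.
Qed.

(** The remainder [r] is tested against itself: along the segment its inner product with [r] grows
    no faster than K t^(1+nu). Hence [enorm r ^+ 2 <= K], and one factor [enorm r] cancels. *)
Lemma grad_taylor f nu rho x z : 0 < nu -> 0 <= rho ->
  (forall u, differentiable (grad f) u) -> holder_hessian nu rho f ->
  enorm (grad f x - grad f z - (x - z) *m hessian f z)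
    <= rho / (1 + nu) * enorm (x - z) `^ (1 + nu).
Proof.
move=> nu0 rho0 df hf; set D := x - z; set r := (X in enorm X).
have nu1 : 0 < 1 + nu by rewrite addr_gt0.
set e := enorm D; have e0 : 0 <= e := enorm_ge0 D.
pose K := rho / (1 + nu) * e `^ (1 + nu) * enorm r.
pose phi0 (t : R) := dot (grad f (z + t *: D)) r - t * dot (D *m hessian f z) r.
pose phi (t : R) := phi0 t - K * t `^ (1 + nu).
have dphi0 (t : R) : is_derive t 1 phi0 (dot (D *m (hessian f (z + t *: D) - hessian f z)) r).
  rewrite mulmxBr dotDl dotNl.
  have H1 : is_derive t 1 (fun s => dot (grad f (z + s *: D)) r)
      (dot (D *m hessian f (z + t *: D)) r).
    rewrite /hessian -(deriveEjacobian D (df (z + t *: D))).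
    by apply: is_derive_dot; apply: is_derive_line; exact: diff_derivable.
  have H2 : is_derive t 1 (fun s : R => s * dot (D *m hessian f z) r)
      (dot (D *m hessian f z) r).
    have -> : (fun s : R => s * dot (D *m hessian f z) r) = (dot (D *m hessian f z) r) \*: id.
      by apply/funext => s; rewrite mulrC.
    by rewrite -[X in is_derive _ _ _ X]mulr1; apply: is_deriveZ.
  exact: (is_deriveB H1 H2).
have dphi (t : R) : 0 < t -> is_derive t 1 phi
    (dot (D *m (hessian f (z + t *: D) - hessian f z)) r - K * ((1 + nu) * t `^ (1 + nu - 1))).
  move=> t0; have H : is_derive t 1 (fun s : R => K * s `^ (1 + nu)) (K * ((1 + nu) * t `^ (1 + nu - 1))).
    exact: (@is_deriveZ _ _ _ (fun s : R => s `^ (1 + nu)) K t 1 _ (is_derive1_powR (1 + nu) t0)).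
  exact: (is_deriveB (dphi0 t) H).
have phi1 : phi 1 <= phi 0.
  have homo_phi := @ler0_derive1_le_cc R phi 0 1.
  apply: homo_phi; [| | | | |exact: ler01].
  - move=> t; rewrite in_itv => /andP[t0 _]; exact: (@ex_derive _ _ _ _ _ _ _ (dphi t t0)).
  - move=> t; rewrite in_itv => /andP[t0 _].
    rewrite derive1E (@derive_val _ _ _ _ _ _ _ (dphi t t0)) subr_le0.
    apply: le_trans (dot_le _ _) _.
    rewrite /K (addrC 1 nu) addrK (addrC nu).
    have -> : rho / (1 + nu) * e `^ (1 + nu) * enorm r * ((1 + nu) * t `^ nu) =
        (rho * (t * e) `^ nu * e) * enorm r.
      rewrite powRM ?(ltW t0) // powRD ?powRr1 //; last by rewrite gt_eqF.
      by field; rewrite gt_eqF.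
    rewrite ler_wpM2r ?enorm_ge0 //; apply: le_trans (opnorm_le _ _) _.
    rewrite ler_wpM2r //; apply: le_trans (hf _ _) _.
    by rewrite addrC addKr enormZ gtr0_norm.
  (* The power t^(1+nu) is differentiated only at t > 0, so continuity at 0 is argued by a one-sided
     limit. *)
  - apply/continuous_within_itvP; first exact: ltr01.
    have c0 t : {for t, continuous phi0}.
      apply: differentiable_continuous; apply/derivable1_diffP.
      exact: (@ex_derive _ _ _ _ _ _ _ (dphi0 t)).
    split.
    + move=> t; rewrite in_itv => /andP[t0 _]; apply: differentiable_continuous.
      apply/derivable1_diffP; exact: (@ex_derive _ _ _ _ _ _ _ (dphi t t0)).
    + rewrite /phi powR0 ?gt_eqF //; apply: cvgB.
        by apply: cvg_at_right_filter; exact: c0.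
      by apply: cvgMr; exact: powR_cvg0.
    + apply: cvg_at_left_filter; apply: differentiable_continuous.
      apply/derivable1_diffP; exact: (@ex_derive _ _ _ _ _ _ _ (dphi 1 ltr01)).
  - by rewrite in_itv /= ler01 lexx.
  - by rewrite in_itv /= ler01 lexx.
have rr : enorm r ^+ 2 <= K.
  have rE : enorm r ^+ 2 = dot (grad f x) r - dot (grad f z) r - dot (D *m hessian f z) r.
    by rewrite enorm_sqr {1}/r !dotDl !dotNl.
  have xE : z + D = x by rewrite /D addrC subrK.
  move: phi1; rewrite /phi /phi0 powR1 powR0 ?gt_eqF // scale1r scale0r addr0 mul0r xE rE.
  lra.
have [r0|r0] := eqVneq (enorm r) 0.
  by rewrite r0 mulr_ge0 ?powR_ge0 // divr_ge0 // ltW.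
by rewrite -(@ler_pM2r _ (enorm r)) -?expr2 // lt_def r0 enorm_ge0.
Qed.

End Hessian.

(** * Proximal operator *)

Section Prox.
Context {R : realType} {d : nat}.
Implicit Types (psi : 'rV[R]_d -> \bar R) (u v x z : 'rV[R]_d) (tau : R).

(** Convexity of [psi] along the segment from x to u turns minimality into a lower bound on the
    increase of [g]. With [g] the smooth function this yields a subgradient; with half the squared
    distance, the optimality condition of [prox]. *)
Lemma argmin_convex psi (g : 'rV[R]_d -> R) tau x :
  0 < tau -> proper_fun psi -> convex_fun psi ->
  argmin (fun u => tau%:E * psi u + (g u)%:E)%E x ->
  exists2 r, psi x = r%:E &
    forall u s, psi u = s%:E -> forall t, 0 < t <= 1 ->
      t * (tau * (r - s)) <= g (x + t *: (u - x)) - g x.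
Proof.
move=> tau0 [psiNy [x0 psi0]] cvx xmin.
have fin u : psi u != +oo%E -> exists s, psi u = s%:E.
  by move: (psiNy u); case: (psi u) => // s; exists s.
have [s0 s0E] := fin _ psi0.
have [r rE] : exists r, psi x = r%:E.
  apply: fin; apply/eqP => xy; have := xmin x0.
  by rewrite xy s0E gt0_muley ?lte_fin // -EFinM -EFinD addye // leye_eq.
exists r => // u s sE t /andP[t0 t1].
have := cvx x u t; rewrite (ltW t0) t1 => /(_ isT).
have -> : (1 - t) *: x + t *: u = x + t *: (u - x).
  by rewrite scalerBl scale1r scalerBr addrAC addrA.
rewrite rE sE -!EFinM -EFinD => cvx_xt.
have [q qE] : exists q, psi (x + t *: (u - x)) = q%:E.
  by apply: fin; apply/eqP => E; move: cvx_xt; rewrite E leye_eq.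
move: cvx_xt; rewrite qE lee_fin => cvx_xt.
have := xmin (x + t *: (u - x)); rewrite rE qE -!EFinM -!EFinD lee_fin.
nra.
Qed.

Lemma argmin_subgradient psi (F : 'rV[R]_d -> R) x :
  proper_fun psi -> convex_fun psi -> differentiable F x ->
  argmin (fun u => (F u)%:E + psi u)%E x ->
  exists2 r, psi x = r%:E &
    forall u, ((r - dot (grad F x) (u - x))%:E <= psi u)%E.
Proof.
move=> ppsi cpsi dF xmin.
have xmin1 : argmin (fun u => 1%:E * psi u + (F u)%:E)%E x.
  by move=> u; rewrite !mul1e addeC [leRHS]addeC; exact: xmin.
have [r rE xmin2] := argmin_convex _ _ _ _ ltr01 ppsi cpsi xmin1.
exists r => // u; move: (ppsi.1 u); case E : (psi u) => [s| |] // _.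
  rewrite lee_fin lerBlDr -lerBlDl -derive_grad //.
  apply: derive_ge; first exact: diff_derivable.
  by move=> t t01; have := xmin2 _ _ E t t01; rewrite mul1r.
by rewrite leey.
Qed.

Lemma continuous_sqr_enorm z : continuous (fun u => enorm (u - z) ^+ 2).
Proof.
have -> : (fun u => enorm (u - z) ^+ 2) =
    (fun u => \sum_(j < d) (u ord0 j - z ord0 j) ^+ 2).
  apply/funext => u; rewrite enorm_sqr; apply: eq_bigr => j _.
  by rewrite !mxE expr2.
apply: continuous_big => [|j _ u]; first exact: add_continuous.
apply: (@continuous_comp _ _ _ (fun u : 'rV[R]_d => u ord0 j - z ord0 j) (fun y => y ^+ 2)).
  by apply: continuousB; [exact: coord_continuous|exact: cst_continuous].
exact: exprn_continuous.
Qed.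

(** [prox] selects by [get], so its argmin set has to be nonempty. On the closed epigraph the
    objective becomes the continuous real function [phi]; the affine minorant bounds the sublevel
    set [A], and compactness gives a minimizer. *)
Lemma prox_exists psi tau x r p z :
  0 < tau -> proper_fun psi -> closed_fun psi -> psi x = r%:E ->
  (forall u, ((r - dot p (u - x))%:E <= psi u)%E) ->
  argmin (fun u => tau%:E * psi u + (2^-1 * enorm (u - z) ^+ 2)%:E)%E !=set0%classic.
Proof.
move=> tau0 [psiNy _] cl xr minor.
pose phi (w : 'rV[R]_d * R) := tau * w.2 + 2^-1 * enorm (w.1 - z) ^+ 2.
pose A := ([set w : 'rV[R]_d * R | (psi w.1 <= w.2%:E)%E] `&`
           phi @^-1` [set y | y <= phi (x, r)])%classic.
have cphi : continuous phi.
  move=> w; apply: cvgD; apply: cvgM; try exact: cvg_cst.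
    exact: cvg_snd.
  apply: (@continuous_comp _ _ _ fst (fun u => enorm (u - z) ^+ 2)); first exact: cvg_fst.
  exact: continuous_sqr_enorm.
have clA : closed A.
  apply: closedI => //; apply: (continuous_closedP phi).1 => //; exact: closed_le.
pose P := enorm p.
(* With s = [enorm (u - z)], the minorant turns the sublevel inequality into s (s/2 - tau P) <= c,
   which fails once s > M. *)
pose c := phi (x, r) - tau * r + tau * P * enorm (z - x).
pose M := 2 * tau * P + 2 * `|c| + 2.
have P0 : 0 <= P := enorm_ge0 p.
have bndA w : A w -> enorm (w.1 - z) <= M /\
    r - P * (M + enorm (z - x)) <= w.2 <= phi (x, r) / tau.
  move: w => [u q] [/= uq]; rewrite {1}/phi /= => phiw.
  have rq : r - P * (enorm (u - z) + enorm (z - x)) <= q.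
    have := le_trans (minor u) uq; rewrite lee_fin; apply: le_trans.
    rewrite lerD2l lerN2; apply: le_trans (dot_le _ _) _.
    by rewrite ler_wpM2l // -[u - x](subrKA z) ler_enormD.
  have s0 := enorm_ge0 (u - z); have n0 := enorm_ge0 (z - x).
  have sM : enorm (u - z) <= M.
    rewrite leNgt; apply/negP => Ms.
    have tq : tau * (r - P * (enorm (u - z) + enorm (z - x))) <= tau * q.
      by rewrite ler_wpM2l // ltW.
    have cs : enorm (u - z) * (2^-1 * enorm (u - z) - tau * P) <= c.
      by rewrite /c; nra.
    have : `|c| + 1 < 2^-1 * enorm (u - z) - tau * P by move: Ms; rewrite /M; lra.
    have tP : 0 <= tau * P by rewrite mulr_ge0 // ltW.
    have s1 : 1 <= enorm (u - z) by move: Ms; rewrite /M; have := normr_ge0 c; nra.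
    have := ler_norm c; have := normr_ge0 c; nra.
  split => //; apply/andP; split.
    by apply: le_trans rq; rewrite lerD2l lerN2 ler_wpM2l // lerD2r.
  by rewrite ler_pdivlMr // mulrC; apply: le_trans phiw; rewrite lerDl mulr_ge0 ?sqr_ge0.
have cptA : compact A.
  apply: (subclosed_compact clA (compact_setX
    (@rV_compact _ d (fun j => `[z ord0 j - M, z ord0 j + M]%classic) _)
    (@segment_compact R (r - P * (M + enorm (z - x))) (phi (x, r) / tau)))).
    by move=> j; exact: segment_compact.
  move=> w /bndA[wM wq]; split => /=; last by rewrite in_itv.
  move=> j; rewrite /= in_itv /= -ler_distl.
  apply: le_trans wM; apply: le_trans (ler_coord_enorm _ j).
  by rewrite !mxE.
have A0 : A !=set0%classic by exists (x, r); split; rewrite /= ?xr.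
have [w wA wmin] := compact_EVT_min A0 cptA (continuous_subspaceT cphi).
move: wA; rewrite inE => -[/= w1 w2].
exists w.1 => u /=.
(* The pair [w] lies in the epigraph, so [phi w] is an upper bound of the objective at [w.1], which
   is the direction needed. *)
have wle : (tau%:E * psi w.1 + (2^-1 * enorm (w.1 - z) ^+ 2)%:E <= (phi w)%:E)%E.
  by rewrite /phi EFinD leeD2r // EFinM lee_wpmul2l // lee_fin ltW.
apply: le_trans wle _.
move: (psiNy u); case E : (psi u) => [s| |] // _; last by rewrite gt0_muley ?lte_fin // addye // leey.
rewrite -EFinM -EFinD lee_fin.
have [us|us] := leP (phi (u, s)) (phi (x, r)).
  by apply: (wmin (u, s)); rewrite inE; split => //=; rewrite E.
by apply: le_trans w2 _; exact: ltW.
Qed.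

(** Adding the optimality inequality of the proximal point u, tested at x, to the subgradient
    inequality at x, tested at u, bounds [enorm (u - x) ^+ 2] by the inner product of
    [z - (x - tau *: p)] and [u - x]. *)
Lemma prox_dist_le psi tau x r p z :
  0 < tau -> proper_fun psi -> closed_fun psi -> convex_fun psi -> psi x = r%:E ->
  (forall u, ((r - dot p (u - x))%:E <= psi u)%E) ->
  enorm (prox tau psi z - x) <= enorm (z - (x - tau *: p)).
Proof.
move=> tau0 ppsi cl cvx xr minor.
have umin : argmin (fun u => tau%:E * psi u + (2^-1 * enorm (u - z) ^+ 2)%:E)%E (prox tau psi z).
  by apply: getPex; exact: (prox_exists psi tau x r p z).
set u := prox tau psi z in umin *.
have [s us umin2] := argmin_convex _ _ _ _ tau0 ppsi cvx umin.
have H1 : tau * (s - r) <= dot (u - z) (x - u).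
  apply/ler_addgt0Pr => e e0.
  (* Small enough for the quadratic term of the squared distance to be absorbed by [e]. *)
  pose t := Num.min 1 (e / (enorm (x - u) ^+ 2 + 1)).
  have n1 : 0 < enorm (x - u) ^+ 2 + 1 by rewrite ltr_wpDl ?sqr_ge0.
  have t0 : 0 < t by rewrite lt_min ltr01 divr_gt0.
  have t1 : t <= 1 by rewrite ge_min lexx.
  have te : t * (enorm (x - u) ^+ 2 + 1) <= e.
    by rewrite -ler_pdivlMr // ge_min lexx orbT.
  have := umin2 x r xr t; rewrite t0 t1 => /(_ isT).
  rewrite [u + _ - z]addrAC (enormD_sqr (u - z) (t *: (x - u))) dotZr enormZ gtr0_norm // => h.
  rewrite -(ler_pM2l t0); apply: le_trans h _.
  have := sqr_ge0 (enorm (x - u)); nra.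
have H2 : r - dot p (u - x) <= s by have := minor u; rewrite us lee_fin.
have H3 : enorm (u - x) ^+ 2 <= enorm (z - (x - tau *: p)) * enorm (u - x).
  apply: le_trans (dot_le _ _); rewrite enorm_sqr.
  have -> : z - (x - tau *: p) = (u - x) - (u - z) + tau *: p.
    by apply/rowP => j; rewrite !mxE; ring.
  rewrite (dotDl (u - x - (u - z))) [dot (_ - (u - z)) _]dotDl dotNl dotZl.
  have : dot (u - z) (x - u) = - dot (u - z) (u - x) by rewrite -dotNr opprB.
  nra.
have [n0|n0] := eqVneq (enorm (u - x)) 0; first by rewrite n0 enorm_ge0.
have np : 0 < enorm (u - x) by rewrite lt_def n0 enorm_ge0.
by rewrite -(ler_pM2r np) -expr2.
Qed.

End Prox.

(** * Averages over permutations *)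

(** Only a uniform permutation is random within an epoch, so finite averages stand in for integrals
    until epochs are iterated. *)
Definition mean {R : realType} {T : finType} (g : T -> R) : R :=
  #|T|%:R^-1 * \sum_t g t.

Definition vmean {R : realType} {T : finType} {d} (g : T -> 'rV[R]_d) : 'rV[R]_d :=
  #|T|%:R^-1 *: \sum_t g t.

Section Mean.
Context {R : realType} {T : finType}.

Lemma eq_mean (g h : T -> R) : g =1 h -> mean g = mean h.
Proof. by move=> gh; congr (_ * _); apply: eq_bigr. Qed.

Lemma meanD (g h : T -> R) : mean (fun t => g t + h t) = mean g + mean h.
Proof. by rewrite /mean big_split mulrDr. Qed.

Lemma meanM (a : R) (g : T -> R) : mean (fun t => a * g t) = a * mean g.
Proof. by rewrite /mean -mulr_sumr mulrCA. Qed.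

Lemma mean_sum (I : Type) (r : seq I) (Q : pred I) (g : I -> T -> R) :
  mean (fun t => \sum_(i <- r | Q i) g i t) = \sum_(i <- r | Q i) mean (g i).
Proof. by rewrite /mean exchange_big /= mulr_sumr. Qed.

Lemma mean_le (g h : T -> R) : (forall t, g t <= h t) -> mean g <= mean h.
Proof. by move=> gh; rewrite ler_wpM2l ?invr_ge0 //; exact: ler_sum. Qed.

Context {d : nat}.
Implicit Types (g h : T -> 'rV[R]_d) (v c : 'rV[R]_d).

Lemma eq_vmean g h : g =1 h -> vmean g = vmean h.
Proof. by move=> gh; congr (_ *: _); apply: eq_bigr. Qed.

Lemma vmeanD g h : vmean (fun t => g t + h t) = vmean g + vmean h.
Proof. by rewrite /vmean big_split scalerDr. Qed.

Lemma vmeanN g : vmean (fun t => - g t) = - vmean g.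
Proof. by rewrite /vmean sumrN scalerN. Qed.

Lemma vmeanB g h : vmean (fun t => g t - h t) = vmean g - vmean h.
Proof. by rewrite vmeanD vmeanN. Qed.

Lemma vmeanZ (a : R) g : vmean (fun t => a *: g t) = a *: vmean g.
Proof. by rewrite /vmean -scaler_sumr !scalerA mulrC. Qed.

Lemma vmean_mulmx g (A : 'M[R]_d) : vmean (fun t => g t *m A) = vmean g *m A.
Proof. by rewrite /vmean -scalemxAl mulmx_suml. Qed.

Lemma enorm_vmean g : enorm (vmean g) <= mean (fun t => enorm (g t)).
Proof.
rewrite /vmean enormZ ger0_norm ?invr_ge0 // ler_wpM2l ?invr_ge0 //.
exact: ler_enorm_sum.
Qed.

Lemma mean_dotl g v : mean (fun t => dot (g t) v) = dot (vmean g) v.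
Proof. by rewrite /vmean dotZl dot_suml. Qed.

Hypothesis T0 : (0 < #|T|)%N.

Let card_neq0 : #|T|%:R != 0 :> R.
Proof. by rewrite pnatr_eq0 -lt0n. Qed.

Lemma mean_cst (a : R) : mean (fun _ : T => a) = a.
Proof. by rewrite /mean sumr_const -[a *+ _]mulr_natl mulKf. Qed.

Lemma vmean_cst v : vmean (fun _ : T => v) = v.
Proof. by rewrite /vmean sumr_const -[v *+ _]scaler_nat scalerA mulVf ?scale1r. Qed.

Lemma mean_le_cst (f : T -> R) a : (forall t, f t <= a) -> mean f <= a.
Proof. by move=> fa; rewrite -[leRHS]mean_cst mean_le. Qed.

(** Bias-variance decomposition: the cross term vanishes because [g t - vmean g] averages to
    zero. *)
Lemma mean_sqr_enormB g c :
  mean (fun t => enorm (g t - c) ^+ 2) =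
  mean (fun t => enorm (g t - vmean g) ^+ 2) + enorm (vmean g - c) ^+ 2.
Proof.
set m := vmean g.
have E t : enorm (g t - c) ^+ 2 =
    enorm (g t - m) ^+ 2 + (2 * dot (g t - m) (m - c) + enorm (m - c) ^+ 2).
  have -> : g t - c = (g t - m) + (m - c) by rewrite subrKA.
  by rewrite enormD_sqr addrA.
rewrite (eq_mean _ _ E) meanD; congr (_ + _).
by rewrite meanD meanM mean_dotl vmeanB vmean_cst subrr dot0l mulr0 add0r mean_cst.
Qed.

Lemma mean_sqr_enorm_le g c :
  mean (fun t => enorm (g t - vmean g) ^+ 2) <= mean (fun t => enorm (g t - c) ^+ 2).
Proof. by rewrite [leRHS]mean_sqr_enormB lerDl sqr_ge0. Qed.

Lemma sum_sub_vmean g : \sum_t (g t - vmean g) = 0.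
Proof.
rewrite sumrB sumr_const -[vmean g *+ _]scaler_nat /vmean scalerA mulfV //.
by rewrite scale1r subrr.
Qed.

Lemma sum_sqr_enorm_le g : \sum_t enorm (g t - vmean g) ^+ 2 <= \sum_t enorm (g t) ^+ 2.
Proof.
have := mean_sqr_enorm_le g 0; rewrite /mean ler_pM2l ?invr_gt0 ?ltr0n //.
by under [leRHS]eq_bigr do rewrite subr0.
Qed.

End Mean.

Lemma vmean_exchange {R : realType} {S T : finType} {d : nat} (g : S -> T -> 'rV[R]_d) :
  vmean (fun t => vmean (fun s => g s t)) = vmean (fun s => vmean (g s)).
Proof. by rewrite /vmean -!scaler_sumr exchange_big !scalerA mulrC. Qed.

Section PermMean.
Context {R : realType} {n d : nat}.
Implicit Types i j m : 'I_n.

Lemma card_perm_gt0 : (0 < #|{: 'S_n}|)%N.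
Proof. by apply/card_gt0P; exists 1%g. Qed.

(** Since [(t * s) j] is [s (t j)], multiplication on the left permutes positions, and it preserves
    the uniform law. *)
Lemma mean_mulg (g : 'S_n -> R) (t : 'S_n) : mean (fun s : 'S_n => g (t * s)%g) = mean g.
Proof. by congr (_ * _); rewrite [RHS](reindex_inj (@mulgI _ t)). Qed.

Lemma vmean_mulg (g : 'S_n -> 'rV[R]_d) (t : 'S_n) :
  vmean (fun s : 'S_n => g (t * s)%g) = vmean g.
Proof. by congr (_ *: _); rewrite [RHS](reindex_inj (@mulgI _ t)). Qed.

Lemma sum_perm (V : nmodType) (b : 'I_n -> V) (s : 'S_n) : \sum_m b (s m) = \sum_p b p.
Proof. by rewrite [RHS](reindex_inj (@perm_inj _ s)). Qed.

Lemma vmean_comp_perm (b : 'I_n -> 'rV[R]_d) (s : 'S_n) :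
  vmean (fun m => b (s m)) = vmean b.
Proof. by rewrite /vmean sum_perm. Qed.

(** Transpositions make the mean the same at every position, and the sum over all positions is the
    sum over all values, whatever [s] is. *)
Lemma mean_perm (b : 'I_n -> R) j : mean (fun s : 'S_n => b (s j)) = mean b.
Proof.
have E m : mean (fun s : 'S_n => b (s m)) = mean (fun s : 'S_n => b (s j)).
  rewrite -(mean_mulg _ (tperm j m)); apply: eq_mean => s.
  by rewrite permM tpermR.
have n0 : (0 < #|'I_n|)%N by rewrite card_ord; apply: leq_ltn_trans (ltn_ord j).
rewrite -[LHS](mean_cst n0) -(eq_mean _ _ E) [in LHS]/mean -mean_sum [in RHS]/mean.
congr (_ * _); rewrite -[RHS](mean_cst card_perm_gt0); apply: eq_mean => s.
exact: sum_perm.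
Qed.

(** The n - 1 positions other than j give equal cross means; together with position j they add up to
    zero because [c] does. *)
Lemma mean_perm_dot (a c : 'I_n -> 'rV[R]_d) j l : j != l -> \sum_p c p = 0 ->
  n.-1%:R * mean (fun s : 'S_n => dot (a (s j)) (c (s l))) =
  - mean (fun p => dot (a p) (c p)).
Proof.
move=> jl c0; set e := mean _.
have E m : m != j -> mean (fun s : 'S_n => dot (a (s j)) (c (s m))) = e.
  move=> mj; rewrite -(mean_mulg _ (tperm l m)); apply: eq_mean => s.
  by rewrite !permM tpermR tpermD // eq_sym.
have -> : n.-1%:R * e = \sum_(m | m != j) mean (fun s : 'S_n => dot (a (s j)) (c (s m))).
  by rewrite (eq_bigr _ E) sumr_const -[#|_|]/#|predC1 j| cardC1 card_ord -[e *+ _]mulr_natl.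
rewrite -mean_sum -(mean_perm _ j) -mulN1r -meanM; apply: eq_mean => s.
have : \sum_m dot (a (s j)) (c (s m)) = 0.
  under eq_bigr do rewrite dotC.
  by rewrite -dot_suml (sum_perm _ c s) c0 dot0l.
by rewrite mulN1r (bigD1 j) //= => /eqP; rewrite addrC addr_eq0 => /eqP.
Qed.

(* Sampling without replacement: the off-diagonal covariances are nonpositive on
   average, which costs only a factor n / (n - 1) compared with independence. *)
Lemma mean_perm_sqr_sum (a : 'I_n -> 'I_n -> 'rV[R]_d) : (2 <= n)%N ->
  (forall j, \sum_p a p j = 0) ->
  mean (fun s : 'S_n => enorm (\sum_j a (s j) j) ^+ 2)
    <= n.-1%:R^-1 * \sum_j \sum_p enorm (a p j) ^+ 2.
Proof.
move=> n2 a0.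
have n0 : 0 < n%:R :> R by rewrite ltr0n; apply: leq_trans n2.
have n1 : 0 < n.-1%:R :> R by rewrite ltr0n; case: n n2 => [|[]].
have nE : n%:R = n.-1%:R + 1 :> R by rewrite natr1 prednK //; apply: leq_trans n2.
pose Q := \sum_j \sum_p enorm (a p j) ^+ 2.
pose S := \sum_p enorm (\sum_j a p j) ^+ 2.
have diag j : mean (fun s : 'S_n => dot (a (s j) j) (a (s j) j)) =
    n%:R^-1 * \sum_p enorm (a p j) ^+ 2.
  rewrite (mean_perm (fun p => dot (a p j) (a p j))) /mean card_ord.
  by congr (_ * _); apply: eq_bigr => p _; rewrite enorm_sqr.
have off j l : l != j -> mean (fun s : 'S_n => dot (a (s j) j) (a (s l) l)) =
    - ((n.-1%:R * n%:R)^-1 * \sum_p dot (a p j) (a p l)).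
  move=> lj; apply: (mulfI (lt0r_neq0 n1)).
  rewrite (mean_perm_dot (a ^~ j) (a ^~ l)) // 1?eq_sym // /mean card_ord mulrN.
  by field; rewrite !lt0r_neq0.
have -> : mean (fun s : 'S_n => enorm (\sum_j a (s j) j) ^+ 2) =
    \sum_j (mean (fun s : 'S_n => dot (a (s j) j) (a (s j) j)) +
       \sum_(l | l != j) mean (fun s : 'S_n => dot (a (s j) j) (a (s l) l))).
  under [RHS]eq_bigr => j _ do rewrite -(bigD1 (P := predT) (F := fun l => mean (fun s : 'S_n => dot (a (s j) j) (a (s l) l))) j isT) -mean_sum.
  rewrite -mean_sum; apply: eq_mean => s; rewrite enorm_sqr dot_suml.
  by apply: eq_bigr => j _; rewrite dotC dot_suml; apply: eq_bigr => l _; exact: dotC.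
have -> : \sum_j (mean (fun s : 'S_n => dot (a (s j) j) (a (s j) j)) +
       \sum_(l | l != j) mean (fun s : 'S_n => dot (a (s j) j) (a (s l) l))) =
   n%:R^-1 * Q - (n.-1%:R * n%:R)^-1 * (S - Q).
  rewrite big_split (eq_bigr _ (fun j _ => diag j)) -mulr_sumr; congr (_ + _).
  under eq_bigr => j _ do rewrite (eq_bigr _ (off j)) sumrN -mulr_sumr.
  rewrite sumrN -mulr_sumr; congr (- (_ * _)).
  have SE : S = \sum_j \sum_l \sum_p dot (a p j) (a p l).
    under [RHS]eq_bigr do rewrite exchange_big.
    rewrite exchange_big; apply: eq_bigr => p _; rewrite enorm_sqr dot_suml.
    by apply: eq_bigr => j _; rewrite dotC dot_suml; apply: eq_bigr => l _; exact: dotC.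
  rewrite SE -sumrB; apply: eq_bigr => j _; rewrite [in RHS](bigD1 j) //=.
  rewrite [X in _ = _ - X](eq_bigr (fun p => dot (a p j) (a p j))); last first.
    by move=> p _; exact: enorm_sqr.
  by rewrite addrAC subrr add0r.
(* Discarding [S] leaves Q/n + Q/((n-1)n) = Q/(n-1). *)
have S0 : 0 <= S by apply: sumr_ge0 => p _; exact: sqr_ge0.
have -> : n.-1%:R^-1 * Q = n%:R^-1 * Q + (n.-1%:R * n%:R)^-1 * Q.
  rewrite nE; field; rewrite -nE; apply/andP; split; exact: lt0r_neq0.
have : 0 <= (n.-1%:R * n%:R)^-1 * S by rewrite mulr_ge0 // invr_ge0 mulr_ge0 // ltW.
by rewrite mulrBr; lra.
Qed.

End PermMean.

(** * One epoch of random reshuffling *)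

(** Bernoulli's inequality in product form: it bounds (1 + x)^n by 1/(1 - n x) when n x < 1. *)
Lemma exprD1_mul_le1 {R : realType} (x : R) n :
  0 <= x -> (1 + x) ^+ n * (1 - n%:R * x) <= 1.
Proof.
move=> x0; elim: n => [|n IH]; first by rewrite expr0 mul0r subr0 mulr1.
apply: le_trans IH; rewrite exprSr -mulrA ler_wpM2l //.
  by rewrite exprn_ge0 // addr_ge0.
rewrite -natr1; have n0 : 0 <= n%:R :> R by []; nra.
Qed.

Lemma exprB1_mul_le1 {R : realType} (x : R) n :
  0 <= x <= 1 -> (1 - x) ^+ n * (1 + n%:R * x) <= 1.
Proof.
move=> /andP[x0 x1]; elim: n => [|n IH]; first by rewrite expr0 mul0r addr0 mulr1.
apply: le_trans IH; rewrite exprSr -mulrA ler_wpM2l //.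
  by rewrite exprn_ge0 // subr_ge0.
rewrite -natr1; have n0 : 0 <= n%:R :> R by []; nra.
Qed.

(** The concave power lies below its tangent at 1; this is Young's inequality with exponents 1/th
    and 1/(1-th), the case th = 1 being an equality. It serves below in place of Jensen's
    inequality. *)
Lemma powR_le_affine {R : realType} (x th : R) :
  0 <= x -> 0 < th <= 1 -> x `^ th <= th * x + (1 - th).
Proof.
move=> x0 /andP[th0]; rewrite le_eqVlt => /predU1P[->|th1].
  by rewrite powRr1 // mul1r subrr addr0.
have := @conjugate_powR R (x `^ th) 1 th^-1 (1 - th)^-1 (powR_ge0 _ _) ler01.
rewrite !invr_gt0 subr_gt0 !invrK subrKC => /(_ th0 th1 erefl).
by rewrite mulr1 -powRrM mulfV ?gt_eqF // powRr1 // powR1 mul1r mulrC.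
Qed.

Section Path.
Context {R : realType} {d n : nat} (f : 'I_n -> 'rV[R]_d -> R) (eta : R).
Implicit Types (s : 'S_n) (y : 'rV[R]_d).

(** Cutting the [foldl] of [rr_epoch] after k steps names the inner iterate x_k; step i, counted
    from 0, uses component [s i]. *)
Definition rr_path s y k :=
  foldl (fun x i => x - eta *: grad (f (s i)) x) y (take k (enum 'I_n)).

Lemma rr_path0 s y : rr_path s y 0 = y.
Proof. by rewrite /rr_path take0. Qed.

Lemma rr_pathS s y (i : 'I_n) :
  rr_path s y i.+1 = rr_path s y i - eta *: grad (f (s i)) (rr_path s y i).
Proof.
by rewrite /rr_path (take_nth i) ?size_enum_ord // foldl_rcons nth_ord_enum.
Qed.

Lemma rr_path_epoch s y : rr_path s y n = rr_epoch f eta s y.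
Proof. by rewrite /rr_path take_oversize // size_enum_ord. Qed.

Lemma sum_ltS (V : zmodType) (k : 'I_n) (F : 'I_n -> V) :
  \sum_(j < n | (j < k.+1)%N) F j = \sum_(j < n | (j < k)%N) F j + F k.
Proof.
rewrite (bigD1 k) //= addrC; congr (_ + _); apply: eq_bigl => j.
by rewrite ltnS ltn_neqAle -val_eqE andbC.
Qed.

Lemma rr_path_sum s y k : (k <= n)%N ->
  rr_path s y k = y - eta *: \sum_(j < n | (j < k)%N) grad (f (s j)) (rr_path s y j).
Proof.
elim: k => [_|k IH kn]; first by rewrite rr_path0 big_pred0 // scaler0 subr0.
have := rr_pathS s y (Ordinal kn); rewrite [nat_of_ord (Ordinal kn)]/= => ->.
have := sum_ltS _ (Ordinal kn) (fun j => grad (f (s j)) (rr_path s y j)).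
rewrite [nat_of_ord (Ordinal kn)]/= => ->.
by rewrite scalerDr opprD addrA -IH // ltnW.
Qed.

End Path.

Lemma grad_avg {R : realType} {d n : nat} (f : 'I_n -> 'rV[R]_d -> R) x :
  (forall i, differentiable (f i) x) ->
  grad (avg f) x = vmean (fun i => grad (f i) x).
Proof.
move=> df; apply/rowP => j; rewrite !mxE card_ord summxE.
have -> : avg f = n%:R^-1 \*: \sum_(i < n) f i.
  by apply/funext => z; rewrite /avg /= fct_sumE.
have dfj i : derivable (f i) x 'e_j by exact: diff_derivable.
rewrite deriveZ; last exact: derivable_sum.
rewrite derive_sum //; congr (_ * _); apply: eq_bigr => i _; by rewrite mxE.
Qed.

Lemma subrBACA (V : zmodType) (a b c e : V) : a - b - (c - e) = a - c - (b - e).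
Proof. by rewrite !opprB addrACA [RHS]addrACA [- b - c]addrC. Qed.

(** * Setting of one epoch, a priori bounds and the exchange argument *)

Section Epoch.
#[local] Opaque rr_path grad enorm.
Context {R : realType} {d n : nat} (f : 'I_n -> 'rV[R]_d -> R).
Context (L mu eta Gs D : R) (xd y : 'rV[R]_d).
Hypotheses (n2 : (2 <= n)%N) (df : forall i x, differentiable (f i) x)
  (lip : forall i, lipschitz_gradient L (f i))
  (mu0 : 0 < mu) (muL : mu <= L) (eta0 : 0 < eta)
  (step : n%:R * eta <= mu / (64 * L ^+ 2))
  (GsP : forall i, enorm (grad (f i) xd) <= Gs)
  (GsD : Gs <= 2 * L * D)
  (yD : enorm (y - xd) <= D).

Let F := avg f.
Let h := n%:R * eta.
Let G := Gs + 2 * L * D.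
Let X (s : 'S_n) k := rr_path f eta s y k.
Let m k := vmean (fun s => X s k).

Let L0 : 0 < L. Proof. exact: lt_le_trans muL. Qed.
Let n0 : 0 < n%:R :> R. Proof. by rewrite ltr0n; apply: leq_trans n2. Qed.
Let h0 : 0 < h. Proof. exact: mulr_gt0. Qed.
Let D0 : 0 <= D. Proof. exact: le_trans (enorm_ge0 _) yD. Qed.
Let ncard : (0 < #|'I_n|)%N. Proof. by rewrite card_ord; apply: leq_trans n2. Qed.
Let scard : (0 < #|{: 'S_n}|)%N := card_perm_gt0.

Let hLL : h * L ^+ 2 <= mu / 64.
Proof.
move: step; rewrite -/h ler_pdivlMr ?mulr_gt0 ?exprn_gt0 //; lra.
Qed.

Let hL : h * L <= 1 / 64.
Proof.
have H : h * L * L <= 64^-1 * L by move: hLL muL; rewrite expr2; lra.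
by move: H; rewrite ler_pM2r //; lra.
Qed.

Let Gs0 : 0 <= Gs.
Proof. exact: le_trans (enorm_ge0 _) (GsP (Ordinal n2)). Qed.

Let LD0 : 0 <= L * D. Proof. by rewrite mulr_ge0 // ltW. Qed.
Let G0 : 0 <= G. Proof. by move: LD0 Gs0; rewrite /G; lra. Qed.
Let G4 : G <= 4 * (L * D). Proof. by move: GsD LD0; rewrite /G; lra. Qed.
Let hG : h * G <= D / 16.
Proof.
apply: (@le_trans _ _ (h * L * (4 * D))); last by move: hL D0; nra.
by rewrite (_ : h * L * (4 * D) = h * (4 * (L * D))); [rewrite ler_wpM2l ?(ltW h0)|ring].
Qed.

Let le_h k : (k <= n)%N -> k%:R * eta <= h.
Proof. by move=> kn; rewrite ler_pM2r // ler_nat. Qed.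

Let etah : eta <= h.
Proof. by rewrite -[leLHS]mul1r ler_pM2r // ler1n; apply: leq_trans n2. Qed.

Lemma grad_near_le i x : enorm (x - xd) <= 2 * D -> enorm (grad (f i) x) <= G.
Proof.
move=> xD; rewrite -(subrK (grad (f i) xd) (grad (f i) x)).
apply: le_trans (ler_enormD _ _) _; rewrite addrC lerD //.
have -> : 2 * L * D = L * (2 * D) by ring.
by apply: le_trans (lip _ _ _) _; rewrite ler_pM2l.
Qed.

Lemma avg_lipschitz : lipschitz_gradient L F.
Proof.
move=> u v; rewrite !grad_avg // -vmeanB; apply: le_trans (enorm_vmean _) _.
by apply: mean_le_cst => // i; exact: lip.
Qed.

(** The two bounds feed each other: within 2D of [xd] every component gradient is at most G, and a
    total displacement of at most h G <= D/16 never leaves that ball. *)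
Lemma rr_path_bound s k : (k <= n)%N ->
  enorm (X s k - y) <= k%:R * eta * G /\ enorm (X s k - xd) <= 2 * D.
Proof.
elim: k => [_|k IH kn].
  rewrite /X rr_path0 subrr enorm0 !mul0r; split => //.
  by apply: le_trans yD _; have := D0; lra.
have [IH1 IH2] := IH (ltnW kn).
have H1 : enorm (X s k.+1 - y) <= k.+1%:R * eta * G.
  rewrite /X (rr_pathS f eta s y (Ordinal kn)) /= -/(X s k) addrAC.
  apply: le_trans (ler_enormB _ _) _; rewrite -natr1 -mulrA mulrDl mul1r mulrA lerD //.
  by rewrite enormZ gtr0_norm // ler_pM2l // grad_near_le.
split => //; rewrite -(subrKA y); apply: le_trans (ler_enormD _ _) _.
have : k.+1%:R * eta * G <= h * G by rewrite ler_wpM2r // le_h.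
have := hG; have := D0; move: H1 yD; lra.
Qed.

Lemma grad_path_le s k i : (k <= n)%N -> enorm (grad (f i) (X s k)) <= G.
Proof. by move=> kn; apply: grad_near_le; have [] := rr_path_bound s k kn. Qed.

Lemma mean_path_bound k : (k <= n)%N ->
  enorm (m k - y) <= k%:R * eta * G /\ enorm (m k - xd) <= 2 * D.
Proof.
move=> kn; rewrite -[y in m k - y](vmean_cst scard) -[xd](vmean_cst scard) -!vmeanB.
by split; apply: le_trans (enorm_vmean _) _; apply: mean_le_cst => // s;
  have [] := rr_path_bound s k kn.
Qed.

(** The power is at most 1/(1 - h L) <= 64/63; the cruder 3/2 yields the constant 3 of the exchange
    bound. *)
Lemma expr_step_le k : (k <= n)%N -> (1 + eta * L) ^+ k <= 3 / 2.
Proof.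
move=> kn.
have eL : 0 <= eta * L by rewrite mulr_ge0 // ltW.
apply: (@le_trans _ _ ((1 + eta * L) ^+ n)).
  by rewrite ler_weXn2l // lerDl.
have := exprD1_mul_le1 _ n eL; rewrite mulrA -/h => H.
have p0 : 0 <= (1 + eta * L) ^+ n by rewrite exprn_ge0 // addr_ge0.
have := hL; nra.
Qed.

(* Swapping positions [a] and [b] of the permutation changes only the step number [b]
   among the first [a] steps. *)
Lemma rr_path_swap s (a b : 'I_n) k : (b < a)%N -> (k <= a)%N ->
  enorm (X (tperm a b * s)%g k - X s k)
    <= if (k <= b)%N then 0 else 2 * eta * G * (1 + eta * L) ^+ k.
Proof.
move=> ba; elim: k => [_|k IH ka]; first by rewrite /X !rr_path0 subrr enorm0.
have kn : (k < n)%N by apply: ltn_trans (ltn_ord a).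
have {}IH := IH (ltnW ka).
have eL : 0 <= eta * L by rewrite mulr_ge0 // ltW.
have eG : 0 <= 2 * eta * G by rewrite !mulr_ge0 // ltW.
have pe j : 1 <= (1 + eta * L) ^+ j by rewrite exprn_ege1 // lerDl.
have XS t : X t k.+1 = X t k - eta *: grad (f (t (Ordinal kn))) (X t k).
  exact: (rr_pathS f eta t y (Ordinal kn)).
rewrite !XS subrBACA -scalerBr permM.
(* At step [b] the paths still agree and then part by at most 2 eta G. At any other step before [a]
   both use the same component, and the gap grows by a factor of at most 1 + eta L. *)
have [kb|kb] := eqVneq (Ordinal kn) b.
  have kbn : k = b by rewrite -kb.
  rewrite -kbn ltnn; rewrite -kbn leqnn in IH.
  have -> : X (tperm a b * s)%g k = X s k.
    by apply/eqP; rewrite -subr_eq0; apply/eqP/enorm_eq0/le_anti; rewrite IH enorm_ge0.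
  rewrite subrr sub0r enormN enormZ gtr0_norm //.
  apply: (@le_trans _ _ (2 * eta * G)); last by rewrite ler_peMr.
  rewrite [2 * eta]mulrC -mulrA ler_pM2l // mulr_natl mulr2n.
  have kn' := ltnW kn.
  by apply: le_trans (ler_enormB _ _) _; rewrite lerD // grad_path_le.
have -> : tperm a b (Ordinal kn) = Ordinal kn.
  by rewrite tpermD // eq_sym // -val_eqE /= ltn_eqF.
apply: le_trans (ler_enormB _ _) _; rewrite enormZ gtr0_norm //.
set e := enorm (X _ k - X s k) in IH *.
apply: (@le_trans _ _ ((1 + eta * L) * e)).
  by rewrite mulrDl mul1r lerD2l -mulrA ler_pM2l //; exact: lip.
have {}kb : (k != b)%N by [].
rewrite ltn_neqAle kb /=.
case: (leqP k b) IH => [_ IH|bk IH].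
  by rewrite -[leRHS](mulr0 (1 + eta * L)) ler_wpM2l // addr_ge0.
by rewrite exprS mulrCA ler_wpM2l // addr_ge0.
Qed.

(** Averaging over all swaps of i with j replaces component [s i] by [s j] at the price of a
    perturbed path, while grad F is the average of the gradients of [f (s j)] over j on the original
    path. The two averages are compared term by term through the Lipschitz bound. *)
Lemma mean_swap_bound (i : 'I_n) :
  enorm (vmean (fun s : 'S_n => grad (f (s i)) (X s i)) - vmean (fun s : 'S_n => grad F (X s i)))
    <= 3 * L * eta * G.
Proof.
have eG : 0 <= 2 * eta * G by rewrite !mulr_ge0 // ltW.
have E1 : vmean (fun s : 'S_n => grad (f (s i)) (X s i)) =
    vmean (fun j : 'I_n => vmean (fun s : 'S_n => grad (f (s j)) (X (tperm i j * s)%g i))).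
  rewrite -[LHS](vmean_cst ncard).
  apply: eq_vmean => j.
  rewrite -[LHS](vmean_mulg (fun s : 'S_n => grad (f (s i)) (X s i)) (tperm i j)).
  apply: eq_vmean => s.
  by rewrite permM tpermL.
have E2 : vmean (fun s : 'S_n => grad F (X s i)) =
    vmean (fun j : 'I_n => vmean (fun s : 'S_n => grad (f (s j)) (X s i))).
  rewrite vmean_exchange; apply: eq_vmean => s; rewrite grad_avg //.
  by rewrite -[LHS](vmean_comp_perm (fun p => grad (f p) (X s i)) s).
rewrite E1.
rewrite [X in _ - X]E2.
rewrite -vmeanB.
apply: le_trans (enorm_vmean _) _.
apply: mean_le_cst => [|j]; first exact: ncard.
rewrite -vmeanB; apply: le_trans (enorm_vmean _) _; apply: mean_le_cst => // s.
apply: le_trans (lip _ _ _) _.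
have b0 : 0 <= 3 * L * eta * G by rewrite !mulr_ge0 // ltW.
have -> : 3 * L * eta * G = L * (2 * eta * G * (3 / 2)) by field.
(* For j >= i the first i steps do not see the swap, and the two iterates coincide. *)
rewrite ler_pM2l //; have [ji|ij] := ltnP j i.
  apply: le_trans (rr_path_swap s i j i ji (leqnn _)) _; rewrite leqNgt ji /=.
  by rewrite ler_wpM2l // expr_step_le // ltnW.
have -> : X (tperm i j * s)%g i = X s i.
  have agree k : (k <= i)%N -> X (tperm i j * s)%g k = X s k.
    elim: k => [_|k IH ki]; first by rewrite /X !rr_path0.
    have kn : (k < n)%N by apply: ltn_trans (ltn_ord i).
    have XS t : X t k.+1 = X t k - eta *: grad (f (t (Ordinal kn))) (X t k).
      exact: (rr_pathS f eta t y (Ordinal kn)).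
    have tE : tperm i j (Ordinal kn) = Ordinal kn.
      apply: tpermD; rewrite -val_eqE /=; first by rewrite (gtn_eqF ki).
      by rewrite (gtn_eqF (leq_trans ki ij)).
    by rewrite !XS permM tE (IH (ltnW ki)).
  exact: agree.
by rewrite subrr enorm0 mulr_ge0 // divr_ge0.
Qed.

(** * Variance of the inner iterates *)

Let V k := mean (fun s : 'S_n => enorm (X s k - m k) ^+ 2).
Let noise k (s : 'S_n) :=
  \sum_(j < n | (j < k)%N) (grad (f (s j)) (m j) - grad F (m j)).

(** Variance is at most the second moment about the deterministic point [c]. The deviation from [c]
    is the sampling noise along the means plus a Lipschitz term [B] governed by the earlier
    variances; [a] is the weight in Young's inequality. *)
Let V_le_noise (a W : R) k : 0 < a -> 0 <= W -> (k <= n)%N -> (forall j, (j < k)%N -> V j <= W) ->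
  V k <= eta ^+ 2 * ((1 + a) * mean (fun s => enorm (noise k s) ^+ 2)
                     + (1 + a^-1) * (n%:R ^+ 2 * L ^+ 2 * W)).
Proof.
move=> a0 W0 kn VW.
pose c := y - eta *: \sum_(j < n | (j < k)%N) grad F (m j).
pose B (s : 'S_n) := \sum_(j < n | (j < k)%N) (grad (f (s j)) (X s j) - grad (f (s j)) (m j)).
have E s : X s k - c = (- eta) *: (noise k s + B s).
  rewrite /X (rr_path_sum _ _ _ _ _ kn) /c subrBACA subrr sub0r -scalerBr scaleNr.
  congr (- (_ *: _)); rewrite /noise /B -big_split -sumrB; apply: eq_bigr => j _ /=.
  by rewrite addrC subrKA.
have a1 : 0 <= 1 + a^-1 by rewrite addr_ge0 // invr_ge0 ltW.
apply: (le_trans (mean_sqr_enorm_le scard _ c)).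
have Ele s : enorm (X s k - c) ^+ 2 <= eta ^+ 2 * ((1 + a) * enorm (noise k s) ^+ 2 +
   (1 + a^-1) * (n%:R * L ^+ 2 * \sum_(j < n | (j < k)%N) enorm (X s j - m j) ^+ 2)).
  rewrite E enormZ exprMn real_normK ?num_real // sqrrN ler_pM2l ?exprn_gt0 //.
  apply: le_trans (enormD_sqr_le _ _ _ a0) _; rewrite lerD2l ler_wpM2l //.
  apply: le_trans (sqr_enorm_sum_le _ _) _; rewrite -mulrA ler_pM2l // mulr_sumr.
  apply: ler_sum => j _; rewrite -exprMn ler_pXn2r ?nnegrE ?enorm_ge0 //.
    exact: lip.
  by rewrite mulr_ge0 ?enorm_ge0 // ltW.
apply: le_trans (mean_le _ _ Ele) _.
rewrite meanM ler_pM2l ?exprn_gt0 // meanD !meanM lerD2l ler_wpM2l // mean_sum.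
have SW : \sum_(j < n | (j < k)%N) V j <= n%:R * W.
  rewrite big_mkcond /= mulr_natl -[n in W *+ n]card_ord -sumr_const.
  by apply: ler_sum => j _; case: ifP => // /VW.
rewrite (_ : n%:R ^+ 2 * L ^+ 2 * W = n%:R * L ^+ 2 * (n%:R * W)); last by ring.
by rewrite ler_pM2l // mulr_gt0 ?exprn_gt0.
Qed.

(** Columns j >= k are set to zero so that the full-length sampling bound applies; centring a column
    does not increase its sum of squares. *)
Let sum_perm_le (u : 'I_n -> 'I_n -> 'rV[R]_d) k (C : R) : 0 <= C -> (k <= n)%N ->
  (forall j p : 'I_n, (j < k)%N -> enorm (u p j) ^+ 2 <= C) ->
  mean (fun s : 'S_n => enorm (\sum_(j < n | (j < k)%N)
     (u (s j) j - vmean (fun p => u p j))) ^+ 2) <= n.-1%:R^-1 * (k%:R * (n%:R * C)).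
Proof.
move=> C0 kn uC.
pose a p (j : 'I_n) := if (j < k)%N then u p j - vmean (fun p => u p j) else 0.
have a0 j : \sum_p a p j = 0.
  rewrite /a; case: (_ < k)%N; last by rewrite big1.
  exact: (sum_sub_vmean ncard (fun p => u p j)).
under eq_mean => s.
  rewrite big_mkcond (eq_bigr (fun j => a (s j) j)) //.
  over.
apply: le_trans (mean_perm_sqr_sum _ n2 a0) _.
rewrite ler_wpM2l ?invr_ge0 // (bigID (fun j : 'I_n => (j < k)%N)) /=.
rewrite [X in _ + X]big1 ?addr0; last first.
  move=> j /negbTE jk; apply: big1 => p _; rewrite /a jk enorm0 expr0n.
  by [].
apply: (@le_trans _ _ (\sum_(j < n | (j < k)%N) n%:R * C)).
  apply: ler_sum => j jk.
  apply: (@le_trans _ _ (\sum_p enorm (u p j) ^+ 2)).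
    by rewrite /a jk; exact: (sum_sqr_enorm_le ncard (fun p => u p j)).
  rewrite mulr_natl -[n in C *+ n]card_ord -sumr_const.
  by apply: ler_sum => p _; exact: uC.
by rewrite big_ord_narrow // sumr_const card_ord [leRHS]mulr_natl.
Qed.

Let n10 : 0 < n.-1%:R :> R.
Proof. by rewrite ltr0n -ltnS prednK //; apply: ltnW. Qed.

(** Here k <= n - 1 cancels the sampling factor 1/(n-1). *)
Let noise_bound k : (k < n)%N -> mean (fun s => enorm (noise k s) ^+ 2) <= n%:R * G ^+ 2.
Proof.
move=> kn; rewrite /noise.
under eq_mean => s do under eq_bigr => j _ do rewrite grad_avg //.
apply: le_trans (sum_perm_le (fun p j => grad (f p) (m j)) k (G ^+ 2) (sqr_ge0 _) (ltnW kn) _) _.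
  move=> j p jk; rewrite ler_pXn2r ?nnegrE ?enorm_ge0 //.
  by apply: grad_near_le; have [] := mean_path_bound j (ltnW (ltn_ord j)).
rewrite ler_pdivrMl // ler_wpM2r ?mulr_ge0 ?exprn_ge0 // ler_nat.
by rewrite -ltnS prednK // ltnW.
Qed.

(** Over a full epoch the noise frozen at [y] sums to zero, so each gradient may be replaced by its
    increment from [y], of size at most L (n-1) eta G. One factor n - 1 of its square cancels the
    sampling factor. *)
Let noise_end : mean (fun s => enorm (noise n s) ^+ 2) <= n%:R * (h ^+ 2 * L ^+ 2 * G ^+ 2).
Proof.
pose u p (j : 'I_n) := grad (f p) (m j) - grad (f p) y.
have E s : noise n s =
    \sum_(j < n | (j < n)%N) (u (s j) j - vmean (fun p => u p j)).
  rewrite /noise /u; under [RHS]eq_bigr => j _ do rewrite vmeanB -!grad_avg // subrBACA.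
  rewrite [RHS]sumrB [X in _ = _ - X](_ : _ = 0) ?subr0 //.
  rewrite (eq_bigl xpredT) => [|j]; last by rewrite ltn_ord.
  rewrite (sum_perm _ (fun p => grad (f p) y - grad F y) s) grad_avg //.
  exact: (sum_sub_vmean ncard (fun p => grad (f p) y)).
under eq_mean => s do rewrite E.
set C := (L * (n.-1%:R * eta * G)) ^+ 2.
have C0 : 0 <= L * (n.-1%:R * eta * G) by rewrite !mulr_ge0 // ltW.
apply: le_trans (sum_perm_le u n C (sqr_ge0 _) (leqnn n) _) _.
  move=> j p _; rewrite ler_pXn2r ?nnegrE ?enorm_ge0 //.
  apply: le_trans (lip _ _ _) _; rewrite ler_pM2l //.
  have [H _] := mean_path_bound j (ltnW (ltn_ord j)).
  apply: le_trans H _; rewrite ler_wpM2r // ler_pM2r // ler_nat.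
  by rewrite -ltnS prednK // ltnW.
have -> : n.-1%:R^-1 * (n%:R * (n%:R * C)) =
    n%:R ^+ 2 * n.-1%:R * (eta ^+ 2 * L ^+ 2 * G ^+ 2).
  by rewrite /C; field; rewrite gt_eqF.
have -> : n%:R * (h ^+ 2 * L ^+ 2 * G ^+ 2) = n%:R ^+ 2 * n%:R * (eta ^+ 2 * L ^+ 2 * G ^+ 2).
  by rewrite /h; ring.
apply: ler_wpM2r; first by rewrite -!exprMn sqr_ge0.
by rewrite ler_wpM2l ?sqr_ge0 // ler_nat leq_pred.
Qed.

(** Strong induction with weight a = 1/32; it closes because 33/32 + 33 (26/25)/64^2 <= 26/25. *)
Lemma rr_path_variance k : (k < n)%N -> V k <= 26 / 25 * (n%:R * eta ^+ 2 * G ^+ 2).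
Proof.
elim/ltn_ind: k => k IH kn.
have a0 : 0 < 32^-1 :> R by rewrite invr_gt0.
have W1 : 0 <= 26 / 25 * (n%:R * eta ^+ 2 * G ^+ 2).
  by rewrite !mulr_ge0 ?exprn_ge0 ?invr_ge0 // ltW.
apply: (le_trans (V_le_noise _ _ _ a0 W1 (ltnW kn) (fun j jk => IH j jk (ltn_trans jk kn)))).
have := noise_bound _ kn; set N := mean _ => NG.
have W0 : 0 <= n%:R * eta ^+ 2 * G ^+ 2 by rewrite !mulr_ge0 ?exprn_ge0 // ltW.
set W := n%:R * eta ^+ 2 * G ^+ 2 in W0 *.
have -> : eta ^+ 2 * ((1 + 32^-1) * N + (1 + 32^-1^-1) * (n%:R ^+ 2 * L ^+ 2 * (26 / 25 * W)))
   = 33 / 32 * (eta ^+ 2 * N) + 33 * (26 / 25) * ((h * L) ^+ 2 * W).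
  by rewrite /h; field.
have H1 : eta ^+ 2 * N <= W.
  rewrite (_ : W = eta ^+ 2 * (n%:R * G ^+ 2)); last by rewrite /W; ring.
  by rewrite ler_pM2l ?exprn_gt0.
have H2 : (h * L) ^+ 2 * W <= (1 / 64) ^+ 2 * W.
  by rewrite ler_wpM2r // ler_pXn2r ?nnegrE // mulr_ge0 // ltW.
lra.
Qed.

(** Weight a = 1, which gives 2 + 2 (26/25) = 102/25. *)
Lemma rr_epoch_variance : V n <= 102 / 25 * (n%:R * h ^+ 2 * eta ^+ 2 * L ^+ 2 * G ^+ 2).
Proof.
have W1 : 0 <= 26 / 25 * (n%:R * eta ^+ 2 * G ^+ 2).
  by rewrite !mulr_ge0 ?exprn_ge0 ?invr_ge0 // ltW.
apply: (le_trans (V_le_noise 1 _ _ ltr01 W1 (leqnn n) rr_path_variance)).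
have := noise_end; set N := mean _ => NG.
have : eta ^+ 2 * N <= eta ^+ 2 * (n%:R * (h ^+ 2 * L ^+ 2 * G ^+ 2)).
  by rewrite ler_pM2l ?exprn_gt0.
rewrite invr1 /h; lra.
Qed.

(** * Bias of the mean path, drift inequality and invariant ball *)

Context (nu rho : R).
Hypotheses (nu01 : 0 < nu <= 1) (rho0 : 0 <= rho)
  (scF : strongly_convex mu F) (dF : forall x, differentiable F x)
  (dgF : forall x, differentiable (grad F) x) (hoF : holder_hessian nu rho F).

(** [tau] is the variance bound before the end of the epoch and [e3] the resulting Hoelder bias. The
    terms of [e] are the error of freezing the gradient at [xd] along [p], the exchange bias and
    [e3]. The end point [p n] is the one that the proximal step sends to the minimizer. *)
Let tau := 26 / 25 * (n%:R * eta ^+ 2 * G ^+ 2).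
Let e3 := rho / (1 + nu) * tau `^ ((1 + nu) / 2).
Let b := enorm (grad F xd).
Let e := L * h * b + 3 * L * eta * G + e3.
Let p k := xd - (k%:R * eta) *: grad F xd.

(** Expanding at [m k], the Hessian term averages to zero. The remainder, a power of the squared
    deviation, is bounded by its tangent at [tau], whose mean only involves the variance. *)
Lemma mean_grad_bias k : 0 < G -> (k < n)%N ->
  enorm (vmean (fun s : 'S_n => grad F (X s k)) - grad F (m k)) <= e3.
Proof.
move=> Gp kn; have /andP[nup nu1] := nu01.
have th0 : 0 < (1 + nu) / 2 by rewrite divr_gt0 // addr_gt0.
have th1 : (1 + nu) / 2 <= 1 by rewrite ler_pdivrMr // mul1r -[2]/(1 + 1) lerD2l.
have tau0 : 0 < tau by rewrite !mulr_gt0 ?exprn_gt0 ?invr_gt0.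
have c0 : 0 <= rho / (1 + nu) by rewrite divr_ge0 // addr_ge0 // ltW.
have -> : vmean (fun s : 'S_n => grad F (X s k)) - grad F (m k) =
    vmean (fun s : 'S_n => grad F (X s k) - grad F (m k) - (X s k - m k) *m hessian F (m k)).
  by rewrite !vmeanB vmean_mulmx vmeanB !vmean_cst // subrr mul0mx subr0.
apply: le_trans (enorm_vmean _) _.
have B (s : 'S_n) : enorm (grad F (X s k) - grad F (m k) - (X s k - m k) *m hessian F (m k))
   <= e3 * ((1 + nu) / 2 / tau * enorm (X s k - m k) ^+ 2 + (1 - (1 + nu) / 2)).
  apply: le_trans (grad_taylor _ _ _ _ _ nup rho0 dgF hoF) _.
  rewrite /e3 -[leRHS]mulrA; apply: ler_wpM2l => //; set t := enorm _.
  have t0 : 0 <= t by exact: enorm_ge0.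
  have -> : t `^ (1 + nu) = tau `^ ((1 + nu) / 2) * (t ^+ 2 / tau) `^ ((1 + nu) / 2).
    rewrite -powRM ?divr_ge0 ?sqr_ge0 ?(ltW tau0) // mulrC divfK ?gt_eqF //.
    by rewrite -powR_mulrn // -powRrM mulrC divfK.
  rewrite ler_wpM2l ?powR_ge0 //.
  rewrite (_ : (1 + nu) / 2 / tau * t ^+ 2 = (1 + nu) / 2 * (t ^+ 2 / tau)); last by ring.
  by apply: powR_le_affine; rewrite ?th0 ?th1 ?divr_ge0 ?sqr_ge0 ?(ltW tau0).
apply: le_trans (mean_le _ _ B) _; rewrite meanM meanD meanM mean_cst //.
rewrite -[leRHS]mulr1; apply: ler_wpM2l; first by rewrite mulr_ge0 ?powR_ge0.
have := rr_path_variance _ kn; rewrite -/tau -/(V k) => Vt.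
have : (1 + nu) / 2 / tau * V k <= (1 + nu) / 2.
  by rewrite mulrAC ler_pdivrMr // ler_pM2l.
rewrite -/(V k); lra.
Qed.

(** In the expanded square, strong monotonicity gives -2 a mu and smoothness at most a mu/64; the
    sum stays below the -(19/10) a mu of the squared factor. It is applied with step eta and with
    step h. *)
Lemma gd_contract a u v : 0 < a -> a * L ^+ 2 <= mu / 64 ->
  enorm (u - a *: grad F u - (v - a *: grad F v)) <= (1 - 19 / 20 * (a * mu)) * enorm (u - v).
Proof.
move=> a0 aL.
have amu : a * mu <= 1 / 64.
  have : a * mu * mu <= 64^-1 * mu.
    have : a * mu ^+ 2 <= a * L ^+ 2.
      by rewrite ler_pM2l // ler_pXn2r ?nnegrE // ltW.
    by move: aL; rewrite !expr2; lra.
  by rewrite ler_pM2r //; lra.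
have q0 : 0 <= 1 - 19 / 20 * (a * mu) by lra.
rewrite subrBACA -scalerBr; apply: enorm_le; first by rewrite mulr_ge0 ?enorm_ge0.
rewrite -enorm_sqr enormB_sqr dotZr enormZ gtr0_norm // !exprMn.
have H1 := strongly_convex_grad mu F u v dF scF; rewrite dotC in H1.
have H2 : enorm (grad F u - grad F v) ^+ 2 <= (L * enorm (u - v)) ^+ 2.
  rewrite ler_pXn2r ?nnegrE ?enorm_ge0 // ?mulr_ge0 ?enorm_ge0 ?(ltW L0) //.
  exact: avg_lipschitz.
have H3 : a ^+ 2 * enorm (grad F u - grad F v) ^+ 2 <= a * mu / 64 * enorm (u - v) ^+ 2.
  apply: (@le_trans _ _ (a * (a * L ^+ 2) * enorm (u - v) ^+ 2)).
    rewrite (_ : a * (a * L ^+ 2) * enorm (u - v) ^+ 2 = a ^+ 2 * (L * enorm (u - v)) ^+ 2).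
      by rewrite ler_pM2l // exprn_gt0.
    by ring.
  by rewrite ler_wpM2r ?sqr_ge0 // -[a * mu / 64]mulrA ler_pM2l.
have H4 : a * (mu * enorm (u - v) ^+ 2) <= a * dot (u - v) (grad F u - grad F v).
  by rewrite ler_pM2l.
have H5 : 0 <= (a * mu) ^+ 2 * enorm (u - v) ^+ 2 by rewrite mulr_ge0 ?sqr_ge0.
have H6 : 0 <= a * mu * enorm (u - v) ^+ 2 by rewrite mulr_ge0 ?sqr_ge0 // mulr_ge0 ?(ltW a0) ?(ltW mu0).
move: H3 H4 H5 H6; set E := enorm (u - v) ^+ 2; set g := enorm _ ^+ 2.
set dd := dot _ _; lra.
Qed.

(** Both paths take a gradient step on F up to errors: the exchange bias [A - B], the Hoelder bias,
    and the gradient difference between [p i] and [xd]. *)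
Lemma mean_path_drift (i : 'I_n) : 0 < G ->
  enorm (m i.+1 - p i.+1) <= (1 - 19 / 20 * (eta * mu)) * enorm (m i - p i) + eta * e.
Proof.
move=> Gp.
set A := vmean (fun s : 'S_n => grad (f (s i)) (X s i)).
set B := vmean (fun s : 'S_n => grad F (X s i)).
have mS : m i.+1 = m i - eta *: A.
  rewrite /m /A -vmeanZ -vmeanB; apply: eq_vmean => s; exact: rr_pathS.
have -> : m i.+1 - p i.+1 = (m i - eta *: grad F (m i) - (p i - eta *: grad F (p i)))
    - eta *: ((A - B) + (B - grad F (m i)) + (grad F (p i) - grad F xd)).
  rewrite mS /p -natr1; apply/rowP => j; rewrite !mxE; ring.
apply: le_trans (ler_enormB _ _) _; rewrite lerD //.
  apply: gd_contract => //; apply: le_trans hLL.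
  by rewrite ler_wpM2r ?sqr_ge0.
rewrite enormZ gtr0_norm // ler_pM2l //.
have H1 := mean_swap_bound i; rewrite -/A -/B in H1.
have H2 := mean_grad_bias i Gp (ltn_ord i); rewrite -/B in H2.
have H3 : enorm (grad F (p i) - grad F xd) <= L * h * b.
  apply: le_trans (avg_lipschitz _ _) _; rewrite -mulrA ler_pM2l //.
  rewrite /p addrAC subrr sub0r enormN enormZ ger0_norm; last by rewrite mulr_ge0 // ltW.
  by rewrite ler_wpM2r ?enorm_ge0 // le_h // ltnW.
apply: le_trans (ler_enormD _ _) _.
apply: le_trans (lerD (le_trans (ler_enormD _ _) (lerD H1 H2)) H3) _.
by rewrite /e addrC addrA.
Qed.

Let th := 9 / 10 * (mu * h).

Let muh : mu * h <= 1 / 64.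
Proof. by apply: le_trans hL; rewrite mulrC ler_pM2l. Qed.

Let th0 : 0 < th. Proof. by rewrite !mulr_gt0 ?invr_gt0. Qed.

(** The power is at most 1/(1 + (19/20) mu h); lowering 19/20 to 9/10 pays for the quadratic term,
    since mu h <= 1/64. *)
Let Q_le : (1 - 19 / 20 * (eta * mu)) ^+ n <= 1 - th.
Proof.
have em0 : 0 < eta * mu by rewrite mulr_gt0.
have em1 : eta * mu <= 1 / 64.
  by apply: le_trans muh; rewrite mulrC ler_pM2l.
have H := exprB1_mul_le1 (19 / 20 * (eta * mu)) n.
have {}H : (1 - 19 / 20 * (eta * mu)) ^+ n * (1 + 19 / 20 * (mu * h)) <= 1.
  rewrite (_ : 19 / 20 * (mu * h) = n%:R * (19 / 20 * (eta * mu))); last by rewrite /h; ring.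
  by apply: H; apply/andP; split; lra.
have l0 : 0 < mu * h by rewrite mulr_gt0.
have p1 : 0 < 1 + 19 / 20 * (mu * h) by lra.
rewrite -(ler_pM2r p1); apply: le_trans H _; rewrite /th.
have l1 : 0 <= (mu * h) * (1 / 64 - mu * h) by rewrite mulr_ge0 ?subr_ge0 // ltW.
move: l0 l1; set l := mu * h; lra.
Qed.

Lemma mean_path_dist : 0 < G ->
  enorm (m n - p n) <= (1 - th) * enorm (y - xd) + h * e.
Proof.
move=> Gp; set q := 1 - 19 / 20 * (eta * mu).
have em0 : 0 < eta * mu by rewrite mulr_gt0.
have em1 : eta * mu <= 1 / 64 by apply: le_trans muh; rewrite mulrC ler_pM2l.
have q01 : 0 <= q <= 1 by apply/andP; split; rewrite /q; lra.
have e0 : 0 <= e.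
  rewrite !addr_ge0 // ?mulr_ge0 ?enorm_ge0 ?(ltW L0) ?(ltW h0) ?(ltW eta0) ?powR_ge0 //.
  by have /andP[/ltW nup _] := nu01; rewrite invr_ge0 addr_ge0.
have H k : (k <= n)%N -> enorm (m k - p k) <= q ^+ k * enorm (y - xd) + k%:R * eta * e.
  elim: k => [_|k IH kn].
    rewrite expr0 mul1r !mul0r addr0 /m /p mul0r scale0r subr0.
    rewrite (_ : vmean _ = y) // -[RHS](vmean_cst scard); apply: eq_vmean => s.
    exact: rr_path0.
  apply: le_trans (mean_path_drift (Ordinal kn) Gp) _.
  have {}IH := IH (ltnW kn).
  have ke0 : 0 <= k%:R * eta * e by rewrite !mulr_ge0 // ltW.
  have /andP[q0 q1] := q01.
  apply: (@le_trans _ _ (q * (q ^+ k * enorm (y - xd) + k%:R * eta * e) + eta * e)).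
    by rewrite lerD2r ler_wpM2l.
  rewrite exprS -natr1; nra.
apply: le_trans (H n (leqnn n)) _; rewrite lerD2r ler_wpM2r ?enorm_ge0 //.
Qed.

(** Bias-variance split about [p n]; the squared bias is then opened by convexity with weights 1 -
    th and th. *)
Lemma epoch_contract : 0 < G ->
  mean (fun s : 'S_n => enorm (X s n - p n) ^+ 2) <=
  (1 - th) * enorm (y - xd) ^+ 2 +
  ((h * e) ^+ 2 / th + 102 / 25 * (n%:R * h ^+ 2 * eta ^+ 2 * L ^+ 2 * G ^+ 2)).
Proof.
move=> Gp; rewrite (mean_sqr_enormB scard) -/(m n) -/(V n).
rewrite [leLHS]addrC [leRHS]addrA; apply: lerD; last exact: rr_epoch_variance.
have H := mean_path_dist Gp.
set De := enorm (y - xd) in H *; set B := h * e in H *.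
apply: (@le_trans _ _ (((1 - th) * De + B) ^+ 2)).
  by rewrite ler_pXn2r ?nnegrE ?enorm_ge0 //; apply: le_trans H; exact: enorm_ge0.
have t1 : th <= 1 by rewrite /th; move: muh; lra.
rewrite -subr_ge0.
have -> : (1 - th) * De ^+ 2 + B ^+ 2 / th - ((1 - th) * De + B) ^+ 2 =
    (1 - th) * (th * De - B) ^+ 2 / th by field; rewrite gt_eqF.
by rewrite divr_ge0 ?(ltW th0) // mulr_ge0 ?sqr_ge0 // subr_ge0.
Qed.

(** This holds for every permutation: an epoch is one full gradient step of length h plus an error
    of at most h mu D/16, which the contraction gain (19/20) h mu D outweighs. Hence the ball of
    radius D is invariant. *)
Lemma epoch_bound s : enorm (X s n - p n) <= D.
Proof.
set S := \sum_(j < n | (j < n)%N) (grad (f (s j)) (X s j) - grad (f (s j)) y).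
have E : X s n - p n = (y - h *: grad F y - (xd - h *: grad F xd)) - eta *: S.
  rewrite /X (rr_path_sum _ _ _ _ _ (leqnn n)) /S sumrB.
  have -> : \sum_(j < n | (j < n)%N) grad (f (s j)) y = n%:R *: grad F y.
    rewrite (eq_bigl xpredT) => [|j]; last by rewrite ltn_ord.
    rewrite (sum_perm _ (fun p => grad (f p) y) s) grad_avg // /vmean card_ord.
    by rewrite scalerA mulfV ?scale1r // gt_eqF.
  by rewrite /p -/h /h; apply/rowP => j; rewrite !mxE; ring.
have SB : enorm S <= n%:R * (L * (h * G)).
  apply: le_trans (ler_enorm_sum _ _ _ _) _.
  rewrite (eq_bigl xpredT) => [|j]; last by rewrite ltn_ord.
  rewrite mulr_natl -[n in _ *+ n]card_ord -sumr_const; apply: ler_sum => j _.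
  apply: le_trans (lip _ _ _) _; rewrite ler_pM2l //.
  have [H _] := rr_path_bound s j (ltnW (ltn_ord j)).
  by apply: le_trans H _; rewrite ler_wpM2r // le_h // ltnW.
rewrite E; apply: le_trans (ler_enormB _ _) _; rewrite enormZ gtr0_norm //.
have H1 := gd_contract h y xd h0 hLL.
have H2 : eta * enorm S <= h * mu * D / 16.
  apply: (@le_trans _ _ (eta * (n%:R * (L * (h * G))))); first by rewrite ler_pM2l.
  apply: (@le_trans _ _ (eta * (n%:R * (L * (h * (4 * (L * D))))))).
    by rewrite !ler_pM2l.
  rewrite (_ : eta * _ = 4 * h * D * (h * L ^+ 2)); last by rewrite /h; ring.
  rewrite (_ : h * mu * D / 16 = 4 * h * D * (mu / 64)); last by field.
  by rewrite ler_wpM2l // !mulr_ge0 // ltW.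
have H3 : (1 - 19 / 20 * (h * mu)) * enorm (y - xd) <= (1 - 19 / 20 * (h * mu)) * D.
  by rewrite ler_wpM2l //; move: muh; rewrite (mulrC mu); lra.
have H4 : 0 <= h * mu * D by rewrite !mulr_ge0 // ltW.
move: H1 H2 H3 H4; lra.
Qed.

End Epoch.

(** * Iterating independent uniform permutations *)

Section RandomIteration.
Local Open Scope classical_set_scope.
Local Open Scope ring_scope.
Context {R : realType} {n : nat} {disp : measure_display}
  {Omega : measurableType disp} (P : probability Omega R) (pi : nat -> Omega -> 'S_n)
  {S : Type} (step : 'S_n -> S -> S) (y0 : S).
Hypotheses (unif : forall k, uniform_perm P (pi k)) (indep : mutually_independent P pi).

Fixpoint rand_iter (s : nat -> 'S_n) k : S :=
  if k is k'.+1 then step (s k') (rand_iter s k') else y0.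

(** The transition operator of the Markov chain, acting on functions of the state. *)
Definition avg_step (phi : S -> R) (y : S) : R := mean (fun s : 'S_n => phi (step s y)).

Let Y k w := rand_iter (fun j => pi j w) k.

Lemma measurable_perm k (A : set 'S_n) : measurable (pi k @^-1` A).
Proof.
have -> : (pi k @^-1` A = \bigcup_(s in A) (pi k @^-1` [set s]))%classic.
  by apply/seteqP; split => [w Aw|w [s As /= ->]] //; exists (pi k w).
apply: fin_bigcup_measurable => [|s _]; first exact: finite_finset.
by have [] := unif k s.
Qed.

(** The state type carries no sigma-algebra: [Y k] depends on finitely many permutations, so the
    preimage of any set is a finite union of events. *)
Lemma measurable_rand_iter k (B : set S) : measurable (Y k @^-1` B)%classic.
Proof.
elim: k B => [|k IH] B.
  have [yB|yB] := pselect (B y0).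
    by rewrite (_ : _ @^-1` _ = setT)%classic //; apply/seteqP; split.
  by rewrite (_ : _ @^-1` _ = set0)%classic //; apply/seteqP; split.
have -> : (Y k.+1 @^-1` B =
    \bigcup_(s in [set: 'S_n]) (pi k @^-1` [set s] `&` Y k @^-1` (step s @^-1` B)))%classic.
  apply/seteqP; split => [w Bw|w [s _ [/= ps Bs]]]; first by exists (pi k w).
  by rewrite /Y /= ps.
apply: fin_bigcup_measurable => [|s _]; first exact: finite_finset.
apply: measurableI; last exact: IH.
exact: measurable_perm.
Qed.

Lemma measurable_fun_rand_iter k (phi : S -> R) D :
  measurable_fun D (fun w => (phi (Y k w))%:E).
Proof.
move=> mD B _; apply: measurableI => //.
exact: (measurable_rand_iter k (fun y => B (phi y)%:E)).
Qed.

Lemma iter_avg_step_mean k (phi : 'S_n -> S -> R) :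
  iter k avg_step (fun y => mean (fun s => phi s y)) =
  (fun y => mean (fun s => iter k avg_step (phi s) y)).
Proof.
elim: k => //= k ->; apply/funext => y; rewrite /avg_step /mean.
by rewrite -!mulr_sumr exchange_big.
Qed.

Lemma probability_capU1 k s (J : {fset nat}) (A : nat -> set 'S_n) : k \notin J ->
  P (pi k @^-1` [set s] `&` \bigcap_(j in [set` J]) (pi j @^-1` A j))%classic =
  ((n`!)%:R^-1%:E * P (\bigcap_(j in [set` J]) (pi j @^-1` A j)))%E.
Proof.
move=> kJ.
pose A' j := if j == k then [set s]%classic else A j.
have AJ : {in J, A' =1 A}.
  by move=> j jJ; rewrite /A'; case: eqP => // jk; rewrite -jk jJ in kJ.
have E : (\bigcap_(j in [set` J]) (pi j @^-1` A j) =
    \bigcap_(j in [set` J]) (pi j @^-1` A' j))%classic.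
  by apply: eq_bigcapr => j /= jJ; rewrite AJ.
rewrite E [X in P (X `&` _)%classic](_ : _ = pi k @^-1` A' k)%classic; last by rewrite /A' eqxx.
rewrite -(bigcap_fsetU1 (fun j => pi j @^-1` A' j)%classic) !indep.
rewrite big_fsetU1 //=; congr (_ * _)%E.
by rewrite /A' eqxx; have [] := unif k s.
Qed.

(* Integrating over an event that concerns only the permutations from epoch k on is
   what makes the induction on k go through. *)
Lemma integral_rand_iter k (phi : S -> R) (J : {fset nat}) (A : nat -> set 'S_n) :
  (forall y, 0 <= phi y) -> (forall j, j \in J -> (k <= j)%N) ->
  (\int[P]_(w in \bigcap_(j in [set` J]) (pi j @^-1` A j)) (phi (Y k w))%:E =
   (iter k avg_step phi y0)%:E * P (\bigcap_(j in [set` J]) (pi j @^-1` A j)))%E.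
Proof.
have mC (J' : {fset nat}) A' : measurable (\bigcap_(j in [set` J']) (pi j @^-1` A' j))%classic.
  by rewrite bigcap_fset; apply: bigsetI_measurable => j _; exact: measurable_perm.
elim: k phi J A => [|k IH] phi J A phi0 Jk.
  by rewrite -(integral_cst P (mC J A)).
set C := (\bigcap_(j in _) _)%classic.
have kJ : k \notin J by apply/negP => /Jk; rewrite ltnn.
pose F s := (pi k @^-1` [set s] `&` C)%classic.
have mF s : measurable (F s) by apply: measurableI; [exact: measurable_perm|exact: mC].
(* The event is partitioned by the value of [pi k]. *)
have CE : C = (\big[setU/set0]_(s <- index_enum 'S_n) F s)%classic.
  rewrite -bigcup_seq; apply/seteqP; split => [w Cw|w [s _ []]] //.
  by exists (pi k w) => //=; rewrite mem_index_enum.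
rewrite [in LHS]CE ge0_integral_bigsetU //; last first.
- by move=> w _; rewrite lee_fin.
- exact: measurable_fun_rand_iter.
- by apply/trivIsetP => s t _ _ /eqP st; rewrite -subset0 => w [[/= ps _] [/= pt _]]; case: st; rewrite -ps -pt.
- exact: index_enum_uniq.
have Is s : (\int[P]_(w in F s) (phi (Y k.+1 w))%:E =
    ((n`!)%:R^-1 * iter k avg_step (phi \o step s) y0)%:E * P C)%E.
  (* On each piece the condition on [pi k] becomes one more constraint of index k, so the induction
     hypothesis applies to [phi \o step s]. *)
  pose A' j := if j == k then [set s]%classic else A j.
  have FE : F s = (\bigcap_(j in [set` (k |` J)%fset]) (pi j @^-1` A' j))%classic.
    rewrite bigcap_fsetU1 /F /A' eqxx; congr (_ `&` _)%classic.
    apply: eq_bigcapr => j /= jJ; case: eqP => // jk.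
    by rewrite -jk jJ in kJ.
  rewrite (eq_integral (fun w => ((phi \o step s) (Y k w))%:E)); last first.
    by move=> w; rewrite inE => -[/= ps _]; rewrite /Y /= ps.
  rewrite {1}FE IH //; last first.
  - by move=> j; rewrite in_fset1U => /predU1P[->//|/Jk /ltnW].
  - by move=> y /=.
  by rewrite -FE /F probability_capU1 // muleA -EFinM mulrC.
rewrite (eq_bigr _ (fun s _ => Is s)) -[P C]fineK ?fin_num_measure //; last exact: mC.
under eq_bigr do rewrite -EFinM.
rewrite sumEFin -EFinM -mulr_suml; congr ((_ * _)%:E).
rewrite iterSr [avg_step phi](_ : _ = fun y => mean (fun s => (phi \o step s) y)) //.
by rewrite iter_avg_step_mean /mean -mulr_sumr card_Sn.
Qed.

Lemma expectation_rand_iter k (phi : S -> R) : (forall y, 0 <= phi y) ->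
  ('E_P[fun w => phi (rand_iter (fun j => pi j w) k)] = (iter k avg_step phi y0)%:E)%E.
Proof.
move=> phi0; rewrite unlock.
have J0 j : j \in (fset0 : {fset nat}) -> (k <= j)%N by rewrite in_fset0.
have := integral_rand_iter k phi fset0 (fun=> setT) phi0 J0.
by rewrite !bigcap_fset !big_seq_fset0 probability_setT mule1.
Qed.

Lemma iter_avg_step_le k (phi : S -> R) (B : set S) (q N : R) :
  0 <= q < 1 -> 0 <= N -> (forall s y, B y -> B (step s y)) ->
  (forall y, B y -> avg_step phi y <= q * phi y + N) ->
  forall y, B y -> iter k avg_step phi y <= q ^+ k * phi y + N / (1 - q).
Proof.
move=> /andP[q0 q1] N0 stepB drift; have q1' : 0 < 1 - q by rewrite subr_gt0.
(* The factor 1 - q^k, a truncated geometric sum, makes the induction close; it is dropped at the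
   end. *)
have H : forall y, B y -> iter k avg_step phi y <= q ^+ k * phi y + N / (1 - q) * (1 - q ^+ k).
  elim: k => [|k IH] y By; first by rewrite expr0 mul1r subrr mulr0 addr0.
  have IHs s := IH _ (stepB s _ By).
  apply: le_trans (mean_le _ _ IHs) _.
  rewrite meanD meanM mean_cst ?card_perm_gt0 // -/(avg_step phi y).
  have : q ^+ k * avg_step phi y <= q ^+ k * (q * phi y + N).
    by rewrite ler_wpM2l ?exprn_ge0 // drift.
  rewrite -(lerD2r (N / (1 - q) * (1 - q ^+ k))) => /le_trans; apply.
  rewrite exprSr le_eqVlt; apply/orP; left; apply/eqP; field.
  by rewrite gt_eqF.
move=> y By; apply: le_trans (H y By) _; rewrite lerD2l ler_piMr ?divr_ge0 ?(ltW q1') //.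
by rewrite gerBl exprn_ge0.
Qed.

End RandomIteration.

(** * The final estimate *)

(* Cauchy-Schwarz with the weights 1/10, 1/5 and 7/10. *)
Lemma sqr_sum3_le {R : realFieldType} (a b c : R) :
  (a + b + c) ^+ 2 <= 10 * a ^+ 2 + 5 * b ^+ 2 + 10 / 7 * c ^+ 2.
Proof.
have := sqr_ge0 (2 * a - b); have := sqr_ge0 (7 * a - c).
have := sqr_ge0 (7 * b - 2 * c); lra.
Qed.

(** The squared power of 2 contributes 4^-(1+nu), so (26/25)^(1+nu) is written as (104/25)^(1+nu) /
    4^(1+nu), and 1 + nu <= 2 bounds the numerator. *)
Lemma holder_remainder_sqr {R : realType} (nu rho n eta G : R) :
  0 < nu <= 1 -> 0 <= n -> 0 <= eta -> 0 <= G ->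
  (rho / (1 + nu) * (26 / 25 * (n * eta ^+ 2 * G ^+ 2)) `^ ((1 + nu) / 2)) ^+ 2 <=
  (104 / 25) ^+ 2 * ((2 `^ (- (1 + nu)) / (1 + nu)) ^+ 2 * rho ^+ 2
    * G `^ (2 + 2 * nu) * n `^ (1 + nu) * eta `^ (2 + 2 * nu)).
Proof.
move=> /andP[nu0 nu1] n0 eta0 G0; set p := 1 + nu.
have p0 : 0 < p by rewrite addr_gt0.
have sqrp x : 0 <= x -> (x ^+ 2) `^ p = x `^ (2 + 2 * nu).
  by move=> x0; rewrite -powR_mulrn // -powRrM mulrDr mulr1.
have pow2 : (2 `^ p) ^+ 2 = 4 `^ p :> R.
  rewrite -(powR_mulrn 2 (powR_ge0 2 p)) -powRrM mulrC powRrM powR_mulrn //.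
  by congr (_ `^ _); ring.
have E : (26 / 25) `^ p = (104 / 25) `^ p / 4 `^ p :> R.
  rewrite (_ : 104 / 25 = 26 / 25 * 4 :> R); last by field.
  by rewrite (@powRM _ (26 / 25) 4 p) // mulfK // gt_eqF // powR_gt0.
have S2 x : (x `^ (p / 2)) ^+ 2 = x `^ p by rewrite -powR_mulrn ?powR_ge0 // -powRrM divfK.
rewrite exprMn S2.
have nn : 0 <= n * eta ^+ 2 by rewrite mulr_ge0 ?sqr_ge0.
have nn' : 0 <= n * eta ^+ 2 * G ^+ 2 by rewrite mulr_ge0 ?sqr_ge0.
rewrite (@powRM _ (26 / 25) (n * eta ^+ 2 * G ^+ 2)) // (@powRM _ (n * eta ^+ 2)) ?sqr_ge0 //.
rewrite (@powRM _ n) ?sqr_ge0 // !sqrp // E powRN.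
rewrite !exprMn !exprVn pow2.
set g := G `^ _; set n' := n `^ _; set et := eta `^ _; set q := 4 `^ p.
have q0 : 0 < q by exact: powR_gt0.
have H : (104 / 25) `^ p <= (104 / 25) ^+ 2 :> R.
  by rewrite -[leRHS]powR_mulrn ?ler_powR //; rewrite /p; lra.
have W0 : 0 <= rho ^+ 2 / p ^+ 2 / q * n' * et * g.
  do 3 (apply: mulr_ge0; last exact: powR_ge0).
  by rewrite -expr_div_n divr_ge0 ?sqr_ge0 // ltW.
rewrite [leLHS](_ : _ = (104 / 25) `^ p * (rho ^+ 2 / p ^+ 2 / q * n' * et * g)); last first.
  by field; rewrite !gt_eqF.
rewrite [leRHS](_ : _ = (104 / 25) ^+ 2 * (rho ^+ 2 / p ^+ 2 / q * n' * et * g)); last first.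
  by field; rewrite !gt_eqF.
by rewrite ler_wpM2r.
Qed.

(** Dividing by [th] twice costs 100/81. With the weights of [sqr_sum3_le] this gives 1000/81 <= 18,
    500/81 <= 64/9 and (1000/567)(104/25)^2 <= 32; the variance term gets 68/15 <= 6. *)
Lemma drift_term_le {R : realType} (L mu eta b G n e3 W h th : R) :
  0 < mu -> 0 < eta -> 0 < n -> 0 <= W -> e3 ^+ 2 <= (104 / 25) ^+ 2 * W ->
  h = n * eta -> th = 9 / 10 * (mu * h) ->
  ((h * (L * h * b + 3 * L * eta * G + e3)) ^+ 2 / th
    + 102 / 25 * (n * h ^+ 2 * eta ^+ 2 * L ^+ 2 * G ^+ 2)) / th <=
  18 * L ^+ 2 / mu ^+ 2 * h ^+ 2 * b ^+ 2 + 64 * L ^+ 2 * G ^+ 2 / mu ^+ 2 * eta ^+ 2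
  + 6 * L ^+ 2 * G ^+ 2 / mu * n ^+ 2 * eta ^+ 3 + 32 * W / mu ^+ 2.
Proof.
move=> mu0 eta0 n0 W0 e3W hE thE.
have mu'0 : 0 < mu^-1 by rewrite invr_gt0.
set e := L * h * b + 3 * L * eta * G + e3.
have -> : ((h * e) ^+ 2 / th + 102 / 25 * (n * h ^+ 2 * eta ^+ 2 * L ^+ 2 * G ^+ 2)) / th =
    100 / 81 * (mu^-1 ^+ 2 * e ^+ 2) + 68 / 15 * (L ^+ 2 * G ^+ 2 / mu * n ^+ 2 * eta ^+ 3).
  by rewrite thE hE; field; rewrite !gt_eqF.
have -> : 18 * L ^+ 2 / mu ^+ 2 * h ^+ 2 * b ^+ 2 + 64 * L ^+ 2 * G ^+ 2 / mu ^+ 2 * eta ^+ 2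
  + 6 * L ^+ 2 * G ^+ 2 / mu * n ^+ 2 * eta ^+ 3 + 32 * W / mu ^+ 2 =
  mu^-1 ^+ 2 * (18 * (L * h * b) ^+ 2 + 64 / 9 * (3 * L * eta * G) ^+ 2 + 32 * W)
  + 6 * (L ^+ 2 * G ^+ 2 / mu * n ^+ 2 * eta ^+ 3).
  by field; rewrite gt_eqF.
have V0 : 0 <= L ^+ 2 * G ^+ 2 / mu * n ^+ 2 * eta ^+ 3.
  rewrite mulr_ge0 ?exprn_ge0 ?(ltW eta0) // mulr_ge0 ?exprn_ge0 ?(ltW n0) //.
  by rewrite divr_ge0 ?(ltW mu0) // -exprMn sqr_ge0.
apply: lerD; last by rewrite ler_wpM2r //; lra.
rewrite mulrCA ler_pM2l ?exprn_gt0 //.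
have := sqr_sum3_le (L * h * b) (3 * L * eta * G) e3; rewrite -/e.
have := sqr_ge0 (L * h * b); have := sqr_ge0 (3 * L * eta * G).
move: e3W W0; set x := (L * h * b) ^+ 2; set z := (3 * L * eta * G) ^+ 2.
set e2 := e ^+ 2; set e32 := e3 ^+ 2; lra.
Qed.

Lemma proxrr_rand_iter {R : realType} {d n : nat} (f : 'I_n -> 'rV[R]_d -> R) psi eta y0 s k :
  proxrr f psi eta y0 s k =
  rand_iter (fun t y => prox (n%:R * eta) psi (rr_epoch f eta t y)) y0 s k.
Proof. by elim: k => [|k IH]; [by []|rewrite [LHS]/= [RHS]/= IH]. Qed.

Theorem theorem6p4 (R : realType) (d n : nat)
    (disp : measure_display) (Omega : measurableType disp)
    (P : probability Omega R) (pi : nat -> Omega -> 'S_n)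
    (f : 'I_n -> 'rV[R]_d -> R) (psi : 'rV[R]_d -> \bar R)
    (L mu nu rho eta : R) (y0 xdag : 'rV[R]_d) :
  (2 <= n)%N ->
  (forall k, uniform_perm P (pi k)) ->
  mutually_independent P pi ->
  (forall (i : 'I_n) (x : 'rV[R]_d), differentiable (f i) x) ->
  (forall i, lipschitz_gradient L (f i)) ->
  0 < mu <= L ->
  strongly_convex mu (avg f) ->
  0 < nu <= 1 ->
  0 <= rho ->
  twice_differentiable (avg f) ->
  holder_hessian nu rho (avg f) ->
  proper_fun psi -> closed_fun psi -> convex_fun psi ->
  argmin (fun x => ((avg f x)%:E + psi x)%E) xdag ->
  0 < eta ->
  let h := n%:R * eta in
  h <= mu / (64 * L ^+ 2) ->
  let betastar := enorm (grad (avg f) xdag) in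
  let Gstar := \big[Num.max/0]_(i < n) enorm (grad (f i) xdag) in
  let D := Num.max (enorm (y0 - xdag)) (Gstar / (2 * L)) in
  let G := Gstar + 2 * L * D in
  let c := 2 `^ (- (1 + nu)) / (1 + nu) in
  forall K : nat, (1 <= K)%N ->
  ('E_P[(fun w => enorm (proxrr f psi eta y0 (fun k => pi k w) K - xdag) ^+ 2)%R]
   <= (expR (- (mu * eta * (n * K)%:R / 2)) * D ^+ 2
       + 18 * L ^+ 2 / mu ^+ 2 * h ^+ 2 * betastar ^+ 2
       + 64 * L ^+ 2 * G ^+ 2 / mu ^+ 2 * eta ^+ 2
       + 6 * L ^+ 2 * G ^+ 2 / mu * n%:R ^+ 2 * eta ^+ 3
       + 32 * c ^+ 2 * rho ^+ 2 * G `^ (2 + 2 * nu) / mu ^+ 2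
         * n%:R `^ (1 + nu) * eta `^ (2 + 2 * nu))%R%:E)%E.
Proof.
move=> n2 unif indep df lip /andP[mu0 muL] scF nu01 rho0 [dF dgF] hoF.
move=> ppsi clpsi cvpsi xmin eta0 h step b Gs D G c K _.
have L0 : 0 < L := lt_le_trans mu0 muL.
have n0 : 0 < n%:R :> R by rewrite ltr0n; apply: leq_trans n2.
have h0 : 0 < h by rewrite mulr_gt0.
have GsP i : enorm (grad (f i) xdag) <= Gs by exact: le_bigmax.
have Gs0 : 0 <= Gs := le_trans (enorm_ge0 _) (GsP (Ordinal n2)).
have GsD : Gs <= 2 * L * D.
  by rewrite -ler_pdivrMl ?mulr_gt0 // mulrC le_max lexx orbT.
have yD : enorm (y0 - xdag) <= D by rewrite le_max lexx.
have D0 : 0 <= D := le_trans (enorm_ge0 _) yD.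
have G0 : 0 <= G by rewrite addr_ge0 // !mulr_ge0 // ltW.
have [r rE minor] := argmin_subgradient _ _ _ ppsi cvpsi (dF xdag) xmin.
pose T (s : 'S_n) y := prox h psi (rr_epoch f eta s y).
pose phi y := enorm (y - xdag) ^+ 2.
pose p := xdag - h *: grad (avg f) xdag.
have T_le s y : enorm (T s y - xdag) <= enorm (rr_path f eta s y n - p).
  by rewrite rr_path_epoch; exact: (prox_dist_le _ _ _ _ _ _ h0 ppsi clpsi cvpsi rE minor).
pose B y := enorm (y - xdag) <= D.
have TB s y : B y -> B (T s y).
  move=> By; apply: le_trans (T_le s y) _.
  exact: (epoch_bound f L mu eta Gs D xdag y).
have phi0 y : 0 <= phi y by exact: sqr_ge0.
have -> : ('E_P[(fun w => enorm (proxrr f psi eta y0 (fun k => pi k w) K - xdag) ^+ 2)%R] =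
    'E_P[fun w => phi (rand_iter T y0 (fun k => pi k w) K)])%E.
  congr expectation; apply/funext => w; by rewrite proxrr_rand_iter.
rewrite (expectation_rand_iter P pi T y0 unif indep K phi phi0) lee_fin.
pose W := c ^+ 2 * rho ^+ 2 * G `^ (2 + 2 * nu) * n%:R `^ (1 + nu) * eta `^ (2 + 2 * nu).
have W0 : 0 <= W.
  do 3 (apply: mulr_ge0; last exact: powR_ge0).
  by rewrite -exprMn sqr_ge0.
pose th := 9 / 10 * (mu * h).
have muh : mu * h <= 1 / 64.
  have L2 : 0 < L ^+ 2 by rewrite exprn_gt0.
  have hL : h * (64 * L ^+ 2) <= mu by rewrite -ler_pdivlMr ?mulr_gt0.
  have muL2 : mu * mu <= L ^+ 2 by rewrite expr2 ler_pM // ltW.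
  have H : mu * (h * (64 * L ^+ 2)) <= mu * mu by rewrite ler_pM2l.
  by rewrite -(ler_pM2r L2); move: H muL2; lra.
have th0 : 0 < th by rewrite !mulr_gt0 ?invr_gt0.
have th1 : 0 <= 1 - th < 1 by apply/andP; split; move: th0 muh; rewrite /th; lra.
pose e := L * h * b + 3 * L * eta * G
  + rho / (1 + nu) * (26 / 25 * (n%:R * eta ^+ 2 * G ^+ 2)) `^ ((1 + nu) / 2).
pose N := (h * e) ^+ 2 / th + 102 / 25 * (n%:R * h ^+ 2 * eta ^+ 2 * L ^+ 2 * G ^+ 2).
have N0 : 0 <= N.
  apply: addr_ge0; first by rewrite divr_ge0 ?sqr_ge0 ?ltW.
  rewrite (_ : n%:R * _ * _ * _ * _ = n%:R * (h * eta * L * G) ^+ 2); last by ring.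
  apply: mulr_ge0; first by rewrite divr_ge0.
  by apply: mulr_ge0; [exact: ltW|exact: sqr_ge0].
have drift y : B y -> avg_step T phi y <= (1 - th) * phi y + N.
  (* [epoch_contract] needs G > 0. If G = 0 then D = 0, and the invariant ball reduces to [xdag]. *)
  move=> By; have [G00|G00] := eqVneq G 0.
    have D00 : D = 0.
      apply/eqP; move/eqP: G00; rewrite /G paddr_eq0 // => [/andP[_]|].
        by rewrite !mulf_eq0 pnatr_eq0 (gt_eqF L0).
      by rewrite !mulr_ge0 // ltW.
    apply: (@le_trans _ _ 0); last first.
      by rewrite addr_ge0 // mulr_ge0 //; case/andP: th1.
    apply: mean_le_cst => [|s]; first exact: card_perm_gt0.
    have := TB s y By; rewrite /B D00 => Ty.
    have Ty0 : T s y - xdag = 0 by apply/enorm_eq0/le_anti; rewrite Ty enorm_ge0.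
    by rewrite /phi Ty0 enorm0 expr0n.
  have Gp : 0 < G by rewrite lt_def G00.
  have contract := epoch_contract f L mu eta Gs D xdag y n2 df lip mu0 muL eta0 step GsP
    GsD By nu rho nu01 rho0 scF dF dgF hoF Gp.
  apply: le_trans contract; apply: mean_le => s.
  rewrite ler_pXn2r ?nnegrE ?enorm_ge0 //; exact: T_le.
have iter_le := iter_avg_step_le T K phi B (1 - th) N th1 N0 TB drift y0 yD.
rewrite subKr in iter_le.
rewrite [X in _ <= _ + X](_ : _ = 32 * W / mu ^+ 2); last first.
  by rewrite /W; field; rewrite gt_eqF.
rewrite -!addrA; apply: le_trans iter_le _; apply: lerD.
  apply: ler_pM; [by rewrite exprn_ge0 //; case/andP: th1|exact: phi0| |]; last first.
    by rewrite ler_pXn2r ?nnegrE ?enorm_ge0.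
  have -> : - (mu * eta * (n * K)%:R / 2) = K%:R * - (mu * h / 2).
    by rewrite natrM /h; field.
  rewrite expRM_natl; apply: lerXn2r; rewrite ?nnegrE ?expR_ge0 //; first by case/andP: th1.
  (* The rate 9/10 exceeds the 1/2 of the exponent, so 1 - th <= 1 - mu h/2 <= exp(-mu h/2). *)
  apply: le_trans (expR_ge1Dx _); rewrite lerD2l lerN2 /th.
  by have := mulr_gt0 mu0 h0; lra.
rewrite !addrA; apply: drift_term_le => //.
exact: holder_remainder_sqr nu01 (ltW n0) (ltW eta0) G0.
Qed.
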